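(* Let $s_1,\ldots,s_k$ be arbitrary integers and let $f(x),g(x)\in\mathbb{Z}[x]$ have positive leading coefficients. Then \[ S_{f(p),g(p)}(s_1,\ldots,s_k)\in\mathrm{Fil}^{-\deg(f)\left([s_1]^++\cdots+[s_k]^+\right)}\mathcal{M},\qquad S^{(p)}_{f(p),g(p)}(s_1,\ldots,s_k)\in\mathrm{Fil}^0\mathcal{M}. \]
   Context: For non-negative integers $N,M$ and arbitrary integers $s_1,\ldots,s_k$: $S_{N,M}(s_1,\ldots,s_k):=\sum_{N\geq n_1>\cdots>n_k\geq M+1}\frac{1}{n_1^{s_1}\cdots n_k^{s_k}}$ and $S^{(p)}_{N,M}(s_1,\ldots,s_k)$ is the same sum restricted to $p\nmid n_1\cdots n_k$. $[n]^+$ is $n$ if $n>0$ and $0$ otherwise. A composition is a finite list $\mathbf{s}=(s_1,\ldots,s_j)$ of positive integers, $|\mathbf{s}|=s_1+\cdots+s_j$, and $H_N(\mathbf{s})=\sum_{N\ge n_1>\cdots>n_j\ge1}\prod n_i^{-s_i}$. Let $\mathbb{Q}_{p\to\infty}$ be the quotient of the ring of sequences $(a_p)_p\in\prod_p\mathbb{Q}_p$ (indexed by primes) with $v_p(a_p)$ bounded below, by the ideal of sequences with $v_p(a_p)\to\infty$; a quantity defined for all but finitely many $p$ gives an element of it. It is a complete topological ring with filtration $\mathrm{Fil}^n\mathbb{Q}_{p\to\infty}=\{(a_p): a_p\in p^n\mathbb{Z}_p$ for all but finitely many $p\}$. The MHS algebra $\mathcal{M}\subset\mathbb{Q}_{p\to\infty}$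 consists of those $(a_p)$ for which there are rationals $c_i$, integers $b_i\to\infty$ and compositions $\mathbf{s}_i$, independent of $p$, with $(a_p)=\sum_{i\ge1}c_ip^{b_i}H_{p-1}(\mathbf{s}_i)$ in $\mathbb{Q}_{p\to\infty}$ (equivalently, for every integer $n$, $a_p\equiv\sum_{b_i<n}c_ip^{b_i}H_{p-1}(\mathbf{s}_i)\pmod{p^n}$ for all sufficiently large $p$). $\mathrm{Fil}^n\mathcal{M}$ is the set of $(a_p)\in\mathcal{M}$ admitting such an expansion with $b_i\geq n$ for all $i$. *)

(* Defs.v *)
From HB Require Import structures.
From mathcomp Require Import all_boot all_order all_algebra.
From mathcomp Require Import boolp classical_sets functions.

Set Implicit Arguments.
Unset Strict Implicit.
Unset Printing Implicit Defensive.

Import Order.TTheory GRing.Theory Num.Theory.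
Local Open Scope ring_scope.
Local Open Scope quotient_scope.

Definition primeT := {p : nat | prime p}.
Definition nat_of_primeT (p : primeT) : nat := val p.
Coercion nat_of_primeT : primeT >-> nat.

Lemma primeTP (p : primeT) : prime p.
Proof. exact: valP p. Qed.

Definition eventually_nat (P : nat -> Prop) : Prop :=
  exists N : nat, forall i, (N <= i)%N -> P i.

Lemma eventually_natI (P Q : nat -> Prop) :
  eventually_nat P -> eventually_nat Q -> eventually_nat (fun i => P i /\ Q i).
Proof.
move=> [N HN] [M HM]; exists (maxn N M) => i; rewrite geq_max => /andP[h1 h2].
by split; [exact: HN|exact: HM].
Qed.

Definition almost_all_primes (P : primeT -> Prop) : Prop :=
  exists N : nat, forall p : primeT, (N <= p)%N -> P p.

Lemma almost_all_primesI (P Q : primeT -> Prop) :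
  almost_all_primes P -> almost_all_primes Q ->
  almost_all_primes (fun p => P p /\ Q p).
Proof.
move=> [N HN] [M HM]; exists (maxn N M) => i; rewrite geq_max => /andP[h1 h2].
by split; [exact: HN|exact: HM].
Qed.

(* Junk value [vp p 0 = 0]; [vp_ge] treats [0] as having infinite valuation. *)
Definition vp (p : nat) (x : rat) : int :=
  (logn p `|numq x|)%:Z - (logn p `|denq x|)%:Z.

Definition vp_ge (p : nat) (n : int) (x : rat) : Prop :=
  x = 0 \/ n <= vp p x.

Section RatValuation.
Variable p : primeT.
Implicit Types (m n : int) (x y : rat).

Lemma vp_frac (a d : int) : a != 0 -> d != 0 ->
  vp p (a%:~R / d%:~R) = (logn p `|a|)%:Z - (logn p `|d|)%:Z.
Proof.
move=> a0 d0; set x := a%:~R / d%:~R.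
have d0' : d%:~R != 0 :> rat by rewrite intr_eq0.
have x0 : x != 0 by rewrite mulf_neq0 ?invr_eq0 ?intr_eq0.
have E : a * denq x = d * numq x.
  apply/eqP; rewrite -(eqr_int rat) !intrM numqE mulrA; apply/eqP.
  by congr (_ * _); rewrite /x mulrC divfK.
have /(congr1 (fun z => logn p `|z|%N)) := E.
rewrite !abszM !lognM ?absz_gt0 ?denq_neq0 ?numq_eq0 // => H.
rewrite /vp; apply/eqP; rewrite subr_eq addrAC eq_sym subr_eq -!PoszD.
by rewrite H addnC.
Qed.

Lemma vp_ge_frac n (a d : int) : d != 0 ->
  vp_ge p n (a%:~R / d%:~R) <->
  (if (n + (logn p `|d|)%:Z)%R is Posz k then (p ^ k %| `|a|)%N else true).
Proof.
move=> d0; have d0' : d%:~R != 0 :> rat by rewrite intr_eq0.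
have [->|a0] := eqVneq a 0.
  rewrite mul0r; split=> [_|_]; last by left.
  by case: (n + _) => // k; rewrite absz0 dvdn0.
have x0 : a%:~R / d%:~R != 0 :> rat by rewrite mulf_neq0 ?invr_eq0 ?intr_eq0.
have -> : vp_ge p n (a%:~R / d%:~R) <->
          n + (logn p `|d|)%:Z <= (logn p `|a|)%:Z.
  rewrite /vp_ge vp_frac // lerBrDr; split=> [[/eqP|//]|]; last by right.
  by rewrite (negPf x0).
case: (n + _) => [k|k]; last by split.
by rewrite lez_nat pfactor_dvdn ?primeTP // absz_gt0.
Qed.

Lemma rat_frac2 x y : exists a b d : int,
  [/\ d != 0, x = a%:~R / d%:~R & y = b%:~R / d%:~R].
Proof.
exists (numq x * denq y), (numq y * denq x), (denq x * denq y).
have dx : (denq x)%:~R != 0 :> rat by rewrite intr_eq0 denq_neq0.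
have dy : (denq y)%:~R != 0 :> rat by rewrite intr_eq0 denq_neq0.
split; first by rewrite mulf_neq0 ?denq_neq0.
  by rewrite !intrM -mulf_div divff // mulr1 divq_num_den.
by rewrite !intrM [(denq x)%:~R * _]mulrC -mulf_div divff // mulr1 divq_num_den.
Qed.

Lemma vp_ge0 n : vp_ge p n 0. Proof. by left. Qed.

Lemma vp_geN n x : vp_ge p n x -> vp_ge p n (- x).
Proof.
rewrite /vp_ge /vp numqN denqN abszN => -[->|]; last by right.
by left; rewrite oppr0.
Qed.

Lemma vp_geD n x y : vp_ge p n x -> vp_ge p n y -> vp_ge p n (x + y).
Proof.
have [a [b [d [d0 -> ->]]]] := rat_frac2 x y.
rewrite -mulrDl -intrD !vp_ge_frac //; case: (n + _) => // k.
have E c : (p ^ k %| `|c|)%N = (((p ^ k)%N)%:Z %| c)%Z by rewrite dvdzE.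
by rewrite !E => pa pb; exact: rpredD.
Qed.

Lemma vp_geB n x y : vp_ge p n x -> vp_ge p n y -> vp_ge p n (x - y).
Proof. by move=> hx hy; apply: vp_geD => //; apply: vp_geN. Qed.

Lemma vp_geM m n x y : vp_ge p m x -> vp_ge p n y -> vp_ge p (m + n) (x * y).
Proof.
have [->|x0] := eqVneq x 0; first by rewrite mul0r; left.
have [->|y0] := eqVneq y 0; first by rewrite mulr0; left.
move=> [/eqP|mx]; first by rewrite (negPf x0).
move=> [/eqP|ny]; first by rewrite (negPf y0).
right; rewrite -[x]divq_num_den -[y]divq_num_den mulf_div -!intrM.
rewrite vp_frac ?mulf_neq0 ?denq_neq0 ?numq_eq0 //.
rewrite !abszM !lognM ?absz_gt0 ?denq_neq0 ?numq_eq0 // !PoszD opprD.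
by rewrite addrACA lerD.
Qed.

Lemma vp_ge_le m n x : m <= n -> vp_ge p n x -> vp_ge p m x.
Proof. by move=> mn [->|nx]; [left|right; apply: le_trans nx]. Qed.

Lemma vp_ge_int (a : int) : vp_ge p 0 a%:~R.
Proof.
by right; rewrite /vp numq_int denq_int logn1 subr0.
Qed.

Lemma vp_ge_low x : exists n, vp_ge p n x.
Proof. by exists (vp p x); right. Qed.

Lemma vp_ge1F : ~ vp_ge p 1 1.
Proof.
by rewrite /vp_ge /vp (numq_int 1) (denq_int 1) logn1 subr0 => -[].
Qed.

End RatValuation.

Section Padic.
Variable p : primeT.

Definition cauchy_seq (u : nat -> rat) : Prop :=
  forall n : int, exists N : nat, forall i j : nat,
    (N <= i)%N -> (N <= j)%N -> vp_ge p n (u i - u j).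

Definition cauchy_pred : {pred nat -> rat} := [pred u | `[< cauchy_seq u >]].

Lemma cauchy_low u : cauchy_seq u ->
  exists m : int, eventually_nat (fun i => vp_ge p m (u i)).
Proof.
move=> /(_ 0)[N HN]; have [m Hm] := vp_ge_low p (u N).
exists (Num.min 0 m); exists N => i Ni; rewrite -(subrK (u N) (u i)).
apply: vp_geD; [apply: vp_ge_le (HN _ _ Ni (leqnn N))|apply: vp_ge_le Hm].
  by rewrite ge_min lexx.
by rewrite ge_min lexx orbT.
Qed.

Lemma cauchy_subring : subring_closed cauchy_pred.
Proof.
split.
- by apply/asboolP => n; exists 0%N => i j _ _; rewrite subrr; left.
- move=> u v /asboolP cu /asboolP cv; apply/asboolP => n.
  have [N HN] := cu n; have [M HM] := cv n.
  exists (maxn N M) => i j; rewrite !geq_max => /andP[Ni Mi] /andP[Nj Mj].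
  have -> : (u - v) i - (u - v) j = (u i - u j) - (v i - v j).
    by rewrite /= !opprD !opprK addrACA.
  by apply: vp_geB; [apply: HN|apply: HM].
move=> u v /asboolP cu /asboolP cv; apply/asboolP => n.
have [a [A HA]] := cauchy_low cu; have [b [B HB]] := cauchy_low cv.
have [N HN] := cu (n - b); have [M HM] := cv (n - a).
exists (maxn (maxn A B) (maxn N M)) => i j; rewrite !geq_max.
move=> /andP[/andP[Ai Bi] /andP[Ni Mi]] /andP[/andP[Aj Bj] /andP[Nj Mj]].
have -> : (u * v) i - (u * v) j = u i * (v i - v j) + (u i - u j) * v j.
  by rewrite mulrBr mulrBl addrA subrK.
apply: vp_geD.
  by rewrite -(subrKC a n); apply: vp_geM; [apply: HA|apply: HM].
by rewrite -(subrK b n); apply: vp_geM; [apply: HN|apply: HB].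
Qed.

HB.instance Definition _ :=
  GRing.isSubringClosed.Build (nat -> rat) cauchy_pred cauchy_subring.

Definition cauchyQ := {u : nat -> rat | u \in cauchy_pred}.
HB.instance Definition _ := SubChoice.on cauchyQ.
HB.instance Definition _ := [SubChoice_isSubComNzRing of cauchyQ by <:].

Lemma cauchyQP (u : cauchyQ) : cauchy_seq (val u).
Proof. exact/asboolP/(valP u). Qed.

Definition null_seq : {pred cauchyQ} :=
  [pred u | `[< forall n : int,
                eventually_nat (fun i => vp_ge p n (val u i)) >]].

Lemma null_seq_ideal : idealr_closed null_seq.
Proof.
split.
- by apply/asboolP => n; exists 0%N => i _; left.
- by apply/asboolP => /(_ 1)[N /(_ N (leqnn N)) /vp_ge1F].
move=> a u v /asboolP nu /asboolP nv; apply/asboolP => n.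
have [m am] := cauchy_low (cauchyQP a).
have [N HN] := eventually_natI am (eventually_natI (nu (n - m)) (nv n)).
exists N => i /HN[h1 [h2 h3]].
apply: (@vp_geD p n (val a i * val u i) (val v i)) => //.
by rewrite -(subrKC m n); apply: vp_geM.
Qed.

HB.instance Definition _ := isIdealr.Build cauchyQ null_seq null_seq_ideal.

Definition Qp := {ideal_quot null_seq}.
HB.instance Definition _ := GRing.ComNzRing.on Qp.

Lemma cst_cauchy (x : rat) : (fun _ : nat => x) \in cauchy_pred.
Proof. by apply/asboolP => n; exists 0%N => i j _ _; rewrite subrr; left. Qed.

Definition cst_seq (x : rat) : cauchyQ :=
  exist (fun u => u \in cauchy_pred) (fun _ => x) (cst_cauchy x).

Definition Qp_of_rat (x : rat) : Qp := \pi_Qp (cst_seq x).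

(* [Qp_vge n x] is [v_p(x) >= n], i.e. [x] lies in [p^n Z_p]. *)
Definition Qp_vge (n : int) (x : Qp) : Prop :=
  exists u : cauchyQ,
    \pi_Qp u = x /\ eventually_nat (fun i => vp_ge p n (val u i)).

Lemma Qp_vgeP n (u : cauchyQ) :
  Qp_vge n (\pi_Qp u) <-> eventually_nat (fun i => vp_ge p n (val u i)).
Proof.
split=> [[v [/eqP]]|]; last by exists u.
rewrite -Quotient.idealrBE => /asboolP/(_ n) vu vn.
have [N HN] := eventually_natI vu vn; exists N => i /HN[h1 h2].
by rewrite -[val u i](subKr (val v i)); apply: vp_geB.
Qed.

Lemma Qp_vge0 n : Qp_vge n 0.
Proof.
have -> : 0 = \pi_Qp (0 : cauchyQ) by rewrite rmorph0.
by apply/Qp_vgeP; exists 0%N => i _; left.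
Qed.

Lemma Qp_vgeB n (x y : Qp) : Qp_vge n x -> Qp_vge n y -> Qp_vge n (x - y).
Proof.
rewrite -[x]reprK -[y]reprK -rmorphB => /Qp_vgeP hx /Qp_vgeP hy.
apply/Qp_vgeP; have [N HN] := eventually_natI hx hy.
by exists N => i /HN[h1 h2]; apply: vp_geB.
Qed.

Lemma Qp_vgeD n (x y : Qp) : Qp_vge n x -> Qp_vge n y -> Qp_vge n (x + y).
Proof.
move=> hx hy; rewrite -[y]opprK -[- y]add0r; apply: Qp_vgeB => //.
by apply: Qp_vgeB => //; apply: Qp_vge0.
Qed.

Lemma Qp_vgeM m n (x y : Qp) :
  Qp_vge m x -> Qp_vge n y -> Qp_vge (m + n) (x * y).
Proof.
rewrite -[x]reprK -[y]reprK -rmorphM => /Qp_vgeP hx /Qp_vgeP hy.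
apply/Qp_vgeP; have [N HN] := eventually_natI hx hy.
by exists N => i /HN[h1 h2]; apply: vp_geM.
Qed.

Lemma Qp_vge_le m n (x : Qp) : m <= n -> Qp_vge n x -> Qp_vge m x.
Proof.
rewrite -[x]reprK => mn /Qp_vgeP[N HN]; apply/Qp_vgeP.
by exists N => i /HN; apply: vp_ge_le.
Qed.

Lemma Qp_vge_rat n (x : rat) : Qp_vge n (Qp_of_rat x) <-> vp_ge p n x.
Proof.
split=> [/Qp_vgeP[N /(_ N (leqnn N))] //|hx].
by apply/Qp_vgeP; exists 0%N.
Qed.

Lemma Qp_of_rat_is_zmod_morphism : zmod_morphism Qp_of_rat.
Proof.
by move=> x y; rewrite /Qp_of_rat -rmorphB; congr (\pi_Qp _); apply: val_inj.
Qed.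

Lemma Qp_of_rat_is_monoid_morphism : monoid_morphism Qp_of_rat.
Proof.
split=> [|x y].
  rewrite -[RHS](rmorph1 (\pi_Qp : cauchyQ -> Qp)).
  by congr (\pi_Qp _); apply: val_inj.
by rewrite /Qp_of_rat -rmorphM; congr (\pi_Qp _); apply: val_inj.
Qed.

HB.instance Definition _ :=
  GRing.isZmodMorphism.Build rat Qp Qp_of_rat Qp_of_rat_is_zmod_morphism.
HB.instance Definition _ :=
  GRing.isMonoidMorphism.Build rat Qp Qp_of_rat Qp_of_rat_is_monoid_morphism.

Lemma Qp_vge1 : Qp_vge 0 1.
Proof. by rewrite -(rmorph1 Qp_of_rat); apply/Qp_vge_rat/(vp_ge_int p 1). Qed.

Lemma Qp_vge1F : ~ Qp_vge 1 1.
Proof. by rewrite -(rmorph1 Qp_of_rat) => /Qp_vge_rat/vp_ge1F. Qed.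

Lemma vp_geV n x : ~ vp_ge p n x -> x != 0 /\ vp_ge p (- n) x^-1.
Proof.
move=> hn; have x0 : x != 0 by apply/eqP => x0; apply: hn; left.
split=> //; right; rewrite -[x]divq_num_den invf_div.
rewrite vp_frac ?denq_neq0 ?numq_eq0 // -opprB lerN2.
by apply/ltW; rewrite ltNge; apply/negP => h; apply: hn; right.
Qed.

Lemma cauchy_away0 (u : cauchyQ) : u \notin null_seq ->
  exists n : int, eventually_nat (fun i => ~ vp_ge p n (val u i)).
Proof.
move=> /asboolP/existsNP[n hn]; have [N HN] := cauchyQP u n.
exists n, N => i Ni ui; apply: hn; exists N => j Nj.
by rewrite -(subrK (val u i) (val u j)); apply: vp_geD => //; apply: HN.
Qed.

Lemma cauchy_inv (u : cauchyQ) : u \notin null_seq ->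
  (fun i => (val u i)^-1) \in cauchy_pred.
Proof.
move=> /cauchy_away0[n hn]; apply/asboolP => m.
have [N HN] := hn; have [M HM] := cauchyQP u (m + n + n).
exists (maxn N M) => i j; rewrite !geq_max => /andP[Ni Mi] /andP[Nj Mj].
have [ui0 ui] := vp_geV (HN _ Ni); have [uj0 uj] := vp_geV (HN _ Nj).
have -> : (val u i)^-1 - (val u j)^-1 =
          (val u j - val u i) * (val u i)^-1 * (val u j)^-1.
  by rewrite mulrBl divff // mulrBl mul1r mulrAC divff // mul1r.
have -> : m = (m + n + n) - n - n by rewrite !addrK.
by apply: vp_geM => //; apply: vp_geM => //; apply: HM.
Qed.

Lemma Qp_inv_ex (x : Qp) : exists y : Qp, if x != 0 then y * x = 1 else y = 0.
Proof.
have [_|x0] := eqVneq x 0; first by exists 0.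
have nx : repr x \notin null_seq.
  by rewrite -[repr x]subr0 Quotient.idealrBE reprK rmorph0.
exists (\pi_Qp (exist (fun u => u \in cauchy_pred) _ (cauchy_inv nx) : cauchyQ)).
rewrite -[x in _ * x]reprK -rmorphM /= -[RHS](rmorph1 (\pi_Qp : cauchyQ -> Qp)).
apply/eqP; rewrite -Quotient.idealrBE; apply/asboolP => n.
have [m [N HN]] := cauchy_away0 nx; exists N => i /HN/vp_geV[ui _]; left.
by apply/eqP; rewrite subr_eq0; apply/eqP; exact: mulVf.
Qed.

Definition Qp_inv (x : Qp) : Qp := sval (cid (Qp_inv_ex x)).

Lemma Qp_mulVf (x : Qp) : x != 0 -> Qp_inv x * x = 1.
Proof. by rewrite /Qp_inv; case: cid => y /=; case: eqVneq. Qed.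

Lemma Qp_inv0 : Qp_inv 0 = 0.
Proof. by rewrite /Qp_inv; case: cid => y /=; rewrite eqxx. Qed.

HB.instance Definition _ := GRing.ComNzRing_isField.Build Qp Qp_mulVf Qp_inv0.

End Padic.

Definition prodQp := forall p : primeT, Qp p.
HB.instance Definition _ := gen_eqMixin prodQp.
HB.instance Definition _ := gen_choiceMixin prodQp.

Section ProdQp.
Let zero : prodQp := fun p => 0.
Let one : prodQp := fun p => 1.
Let opp (a : prodQp) : prodQp := fun p => - a p.
Let add (a b : prodQp) : prodQp := fun p => a p + b p.
Let mul (a b : prodQp) : prodQp := fun p => a p * b p.

Let addA : associative add.
Proof. by move=> a b c; apply: functional_extensionality_dep => p; apply: addrA. Qed.
Let addC : commutative add.
Proof. by move=> a b; apply: functional_extensionality_dep => p; apply: addrC. Qed.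
Let add0 : left_id zero add.
Proof. by move=> a; apply: functional_extensionality_dep => p; apply: add0r. Qed.
Let addN : left_inverse zero opp add.
Proof. by move=> a; apply: functional_extensionality_dep => p; apply: addNr. Qed.

HB.instance Definition _ := GRing.isZmodule.Build prodQp addA addC add0 addN.

Let mulA : associative mul.
Proof. by move=> a b c; apply: functional_extensionality_dep => p; apply: mulrA. Qed.
Let mulC : commutative mul.
Proof. by move=> a b; apply: functional_extensionality_dep => p; apply: mulrC. Qed.
Let mul1 : left_id one mul.
Proof. by move=> a; apply: functional_extensionality_dep => p; apply: mul1r. Qed.
Let mulD : left_distributive mul add.
Proof. by move=> a b c; apply: functional_extensionality_dep => p; apply: mulrDl. Qed.
Let one_neq0 : one != 0 :> prodQp.
Proof.
apply/eqP => /(congr1 (fun a : prodQp => a (exist _ 2%N isT : primeT))) /eqP.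
by rewrite (negPf (oner_neq0 _)).
Qed.

HB.instance Definition _ :=
  GRing.Zmodule_isComNzRing.Build prodQp mulA mulC mul1 mulD one_neq0.
End ProdQp.

Definition bounded_pred : {pred prodQp} :=
  [pred a : prodQp | `[< exists m : int, forall p, Qp_vge m (a p) >]].

Lemma bounded_subring : subring_closed bounded_pred.
Proof.
split.
- apply/asboolP; exists 0 => p.
  exact: Qp_vge1.
- move=> a b /asboolP[m Hm] /asboolP[n Hn]; apply/asboolP.
  exists (Num.min m n) => p; apply: Qp_vgeB.
    by apply: Qp_vge_le (Hm p); rewrite ge_min lexx.
  by apply: Qp_vge_le (Hn p); rewrite ge_min lexx orbT.
move=> a b /asboolP[m Hm] /asboolP[n Hn]; apply/asboolP.
by exists (m + n) => p; apply: Qp_vgeM.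
Qed.

HB.instance Definition _ :=
  GRing.isSubringClosed.Build prodQp bounded_pred bounded_subring.

Definition boundedQp := {a : prodQp | a \in bounded_pred}.
HB.instance Definition _ := SubChoice.on boundedQp.
HB.instance Definition _ := [SubChoice_isSubComNzRing of boundedQp by <:].

Definition null_family : {pred boundedQp} :=
  [pred a | `[< forall n : int,
                almost_all_primes (fun p => Qp_vge n (val a p)) >]].

Lemma null_family_ideal : idealr_closed null_family.
Proof.
split.
- by apply/asboolP => n; exists 0%N => p _; apply: Qp_vge0.
- apply/asboolP => /(_ 1)[N]; have [q Nq pq] := prime_above N.
  by move=> /(_ (exist _ q pq : primeT) (ltnW Nq)) /Qp_vge1F.
move=> a u v /asboolP nu /asboolP nv; apply/asboolP => n.
have /asboolP[m Hm] := valP a.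
have [N HN] := almost_all_primesI (nu (n - m)) (nv n).
exists N => p /HN[h1 h2].
apply: (@Qp_vgeD p n (val a p * val u p) (val v p)) => //.
by rewrite -(subrKC m n); apply: Qp_vgeM.
Qed.

HB.instance Definition _ :=
  isIdealr.Build boundedQp null_family null_family_ideal.

Definition Qpinf := {ideal_quot null_family}.
HB.instance Definition _ := GRing.ComNzRing.on Qpinf.

(* A quantity defined for almost all [p], here rational-valued, determines an
   element of [Qpinf]: the class of any bounded family which agrees with it at
   almost all [p].  The class exists only if the quantity has valuations bounded
   below at almost all [p], so it is given as a relation. *)
Definition is_class_of (a : primeT -> rat) (x : Qpinf) : Prop :=
  exists u : boundedQp,
    \pi_Qpinf u = x /\
    almost_all_primes (fun p => val u p = Qp_of_rat p (a p)).

Definition Fil (n : int) : set Qpinf :=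
  fun x => exists u : boundedQp,
    \pi_Qpinf u = x /\ almost_all_primes (fun p => Qp_vge n (val u p)).

(* Convergence for the topology defined by the filtration [Fil]. *)
Definition is_series_sum (t : nat -> Qpinf) (x : Qpinf) : Prop :=
  forall n : int, eventually_nat (fun m => Fil n (x - \sum_(i < m) t i)).

(* The sum runs over [N >= n_1 > ... > n_k >= M+1], with [k = size s],
   subject to the further condition [P] on [n_1 ... n_k]. *)
Definition mhs_restr (P : pred nat) (N M : nat) (s : seq int) : rat :=
  \sum_(n : (size s).-tuple 'I_N.+1
         | [&& sorted gtn (map val n), all (fun x : 'I_N.+1 => (M < x)%N) n
             & P (\prod_(i < size s) tnth n i)%N])
    \prod_(i < size s) ((tnth n i : nat)%:R ^ s`_i)^-1.

Definition S_sum (N M : nat) (s : seq int) : rat := mhs_restr predT N M s.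

Definition S_sum_p (p N M : nat) (s : seq int) : rat :=
  mhs_restr (fun m => ~~ (p %| m)%N) N M s.

Definition is_composition (s : seq nat) : bool := all (fun x => (0 < x)%N) s.

Definition H_sum (N : nat) (s : seq nat) : rat := S_sum N 0 (map Posz s).

Definition mhs_expansion (c : nat -> rat) (b : nat -> int)
    (s : nat -> seq nat) (x : Qpinf) : Prop :=
  [/\ forall B : int, eventually_nat (fun i => B <= b i),
      forall i, is_composition (s i)
    & exists2 t : nat -> Qpinf,
        forall i, is_class_of
          (fun p => c i * (p%:R ^ b i) * H_sum p.-1 (s i)) (t i)
        & is_series_sum t x].

Definition MHS : set Qpinf :=
  fun x => exists c b s, mhs_expansion c b s x.

Definition FilMHS (n : int) : set Qpinf :=
  fun x => exists c b s, mhs_expansion c b s x /\ forall i, n <= b i.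

Definition pos_part (n : int) : int := if 0 < n then n else 0.

(* Values of a polynomial with positive leading coefficient are natural numbers
   at almost all [p]; at the other [p] the absolute value is a junk value. *)
Definition poly_val (f : {poly int}) (p : nat) : nat := `|f.[p%:Z]|%N.

(* Main.v *)
Require Import Defs.
From mathcomp Require Import all_boot all_order all_algebra.
From mathcomp Require Import boolp classical_sets.
From mathcomp Require Import ring zify.

(** Cut the range [1 .. p m] into the blocks [(p i, p (i + 1)]]. Splitting a
    nested sum at the block boundaries writes [S_{pm}(s)] as a sum over [i < m]
    of block sums times [S_{pi}(s')] with [s'] shorter than [s]. In a block, the
    binomial series of [(p i + r)^-a] expands the part prime to [p] into powers of
    [p], powers of [i] and sums [H_{p-1}(u)], while the multiple of [p] contributes
    [(p (i + 1))^-a]; hence [S_{pm}(s)] is a [p]-adically convergent combination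
    of products [p^k H_{p-1}(u) S_m(e)]. Writing [f = x q + c] and taking
    [m = q(p)], this gives an induction on [deg f]; the [|c|] remaining terms at
    the end are inverses of polynomials in [p], and the lower bound [g(p)] is
    reached by splitting the range at [g(p)]. Products of the [H_{p-1}(u)] are
    linearised by the quasi-shuffle product and nonpositive exponents are removed
    by summation by parts. The restricted sums only omit the multiples of [p],
    which are the sole source of negative powers of [p]. *)

Set Implicit Arguments.
Unset Strict Implicit.
Unset Printing Implicit Defensive.

Import Order.TTheory GRing.Theory Num.Theory.
Local Open Scope ring_scope.
Local Open Scope quotient_scope.

(** * Rational linear combinations of a family of functions *)

Section Span.
Variable X : Type.
Implicit Types (G : (X -> rat) -> Prop) (phi psi : X -> rat).

Inductive span G : (X -> rat) -> Prop :=
| span_nil phi of (forall x, phi x = 0) : span G phi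
| span_cons c g phi psi of G g & span G phi &
    (forall x, psi x = c * g x + phi x) : span G psi.

Lemma span_ext G phi psi : (forall x, psi x = phi x) -> span G phi -> span G psi.
Proof. by move=> /funext ->. Qed.

Lemma span_gen G g : G g -> span G g.
Proof.
move=> Gg; apply: (@span_cons G 1 g (fun=> 0)) => // [|x]; first exact: span_nil.
by rewrite mul1r addr0.
Qed.

Lemma spanD G phi psi : span G phi -> span G psi ->
  span G (fun x => phi x + psi x).
Proof.
elim=> [f f0|c g f h Gg _ IH hE] sp.
  by apply: span_ext sp => x; rewrite f0 add0r.
by apply: (span_cons Gg (IH sp)) => x; rewrite hE addrA.
Qed.

Lemma spanZ G c phi : span G phi -> span G (fun x => c * phi x).
Proof.
elim=> [f f0|d g f h Gg _ IH hE]; first by apply: span_nil => x; rewrite f0 mulr0.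
by apply: (span_cons Gg IH) => x; rewrite hE mulrDr mulrA.
Qed.

Lemma span_sum G (I : Type) (r : seq I) (F : I -> X -> rat) :
  (forall i, span G (F i)) -> span G (fun x => \sum_(i <- r) F i x).
Proof.
move=> GF; elim: r => [|i r IH].
  by apply: span_nil => x; rewrite big_nil.
by apply: span_ext (spanD (GF i) IH) => x; rewrite big_cons.
Qed.

End Span.

(** Both arguments are decomposed one generator at a time. [K] is an arbitrary predicate closed
    under linear combinations, so that the target may be a span or the larger class [expand]. *)
Lemma span_bilinear (X Y Z : Type) (G : (X -> rat) -> Prop)
    (H : (Y -> rat) -> Prop) (K : (Z -> rat) -> Prop)
    (op : (X -> rat) -> (Y -> rat) -> Z -> rat) :
  K (fun=> 0) ->
  (forall c k l, K k -> K l -> K (fun z => c * k z + l z)) ->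
  (forall c f1 f2 h z, op (fun x => c * f1 x + f2 x) h z =
                       c * op f1 h z + op f2 h z) ->
  (forall c f h1 h2 z, op f (fun y => c * h1 y + h2 y) z =
                       c * op f h1 z + op f h2 z) ->
  (forall g h, G g -> H h -> K (op g h)) ->
  forall phi psi, span G phi -> span H psi -> K (op phi psi).
Proof.
move=> K0 KD opl opr opG phi psi sphi spsi.
have op0l h z : op (fun=> 0) h z = 0.
  have := opl 1 (fun=> 0) (fun=> 0) h z.
  have -> : (fun _ : X => 1 * 0 + 0 : rat) = fun=> 0 by apply: funext => x; rewrite mulr0 addr0.
  by rewrite mul1r => /eqP; rewrite -subr_eq subrr => /eqP.
have op0r f z : op f (fun=> 0) z = 0.
  have := opr 1 f (fun=> 0) (fun=> 0) z.
  have -> : (fun _ : Y => 1 * 0 + 0 : rat) = fun=> 0 by apply: funext => x; rewrite mulr0 addr0.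
  by rewrite mul1r => /eqP; rewrite -subr_eq subrr => /eqP.
elim: sphi => [f /funext ->|c g f f' Gg _ IH /funext ->].
  by rewrite (_ : op _ _ = fun=> 0) //; apply: funext => z; rewrite op0l.
rewrite (_ : op _ _ = fun z => c * op g psi z + op f psi z); last exact/funext/opl.
apply: (KD) => //; elim: spsi {IH} => [h /funext ->|d h k k' Hh _ IH /funext ->].
  by rewrite (_ : op _ _ = fun=> 0) //; apply: funext => z; rewrite op0r.
rewrite (_ : op _ _ = fun z => d * op g h z + op g k z); last exact/funext/opr.
by apply: (KD) => //; apply: opG.
Qed.

(** * Asymptotic expansions in powers of [p] *)

(* Index sets of families over the primes: [pr] is the underlying prime, and
   [dom] restricts the parameters over which estimates are uniform. *)
Record pts := Pts { pt :> Type; pr : pt -> primeT; dom : pt -> Prop }.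

Local Notation q x := ((pr x : nat)%:R : rat).

(** The threshold [M] does not depend on the parameters hidden in [x]. This uniformity allows
    summing such estimates over a range whose length grows with the prime. *)
Definition small (X : pts) (N : nat) (phi : X -> rat) : Prop :=
  exists M, forall x, dom x -> (M <= pr x)%N -> vp_ge (pr x) N (phi x).

Record gens (X : pts) := Gens {
  gen :> (X -> rat) -> Prop;
  gen_small : forall g, gen g -> small 0 g }.

(** An asymptotic series in powers of [p]. Each coefficient [F j] is a finite combination of
    generators, with rational coefficients that are the same for all primes. *)
Definition expand (X : pts) (G : gens X) (phi : X -> rat) : Prop :=
  exists F : nat -> X -> rat, (forall j, span G (F j)) /\
    forall N, small N (fun x => phi x - \sum_(j < N) q x ^+ j * F j x).

Lemma vp_ge_sum (p : primeT) n (I : Type) (r : seq I) (P : pred I) (F : I -> rat) :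
  (forall i, P i -> vp_ge p n (F i)) -> vp_ge p n (\sum_(i <- r | P i) F i).
Proof.
move=> h; elim/big_rec: _ => [|i x Pi]; first exact: vp_ge0.
by apply: vp_geD; apply: h.
Qed.

Lemma vp_ge_nat (p : primeT) (n : nat) : vp_ge p 0 (n%:R : rat).
Proof. exact: (vp_ge_int p n). Qed.

Lemma vp_geX (p : primeT) (n : nat) x : vp_ge p 0 x -> vp_ge p 0 (x ^+ n).
Proof.
move=> hx; elim: n => [|n IH]; first by rewrite expr0; exact: (vp_ge_nat p 1).
by rewrite exprS -[0]addr0; apply: vp_geM.
Qed.

Lemma vp_ge_pX (p : primeT) (n : nat) : vp_ge p n ((p : nat)%:R ^+ n : rat).
Proof.
rewrite -natrX; right; rewrite /vp (numq_int (p ^ n)%N) (denq_int (p ^ n)%N).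
by rewrite logn1 subr0 /= pfactorK // primeTP.
Qed.

Section Small.
Variable X : pts.
Implicit Types (phi psi : X -> rat).

Lemma small_ext N phi psi :
  (exists M, forall x, dom x -> (M <= pr x)%N -> psi x = phi x) ->
  small N phi -> small N psi.
Proof.
move=> [M HM] [M' HM']; exists (maxn M M') => x dx; rewrite geq_max.
by move=> /andP[h1 h2]; rewrite HM //; apply: HM'.
Qed.

Lemma smallD N phi psi :
  small N phi -> small N psi -> small N (fun x => phi x + psi x).
Proof.
move=> [M HM] [M' HM']; exists (maxn M M') => x dx; rewrite geq_max.
by move=> /andP[h1 h2]; apply: vp_geD; [apply: HM|apply: HM'].
Qed.

Lemma small0 N : small N (fun _ : X => 0).
Proof. by exists 0%N => x _ _; apply: vp_ge0. Qed.

Lemma smallM N N' phi psi :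
  small N phi -> small N' psi -> small (N + N') (fun x => phi x * psi x).
Proof.
move=> [M HM] [M' HM']; exists (maxn M M') => x dx; rewrite geq_max.
by move=> /andP[h1 h2]; rewrite PoszD; apply: vp_geM; [apply: HM|apply: HM'].
Qed.

Lemma small_le N N' phi : (N <= N')%N -> small N' phi -> small N phi.
Proof. by move=> le [M HM]; exists M => x dx /(HM x dx); apply: vp_ge_le. Qed.

Lemma small_sum N n (F : nat -> X -> rat) :
  (forall i, (i < n)%N -> small N (F i)) -> small N (fun x => \sum_(i < n) F i x).
Proof.
elim: n => [|n IH] h.
  by apply: small_ext (small0 N); exists 0%N => x _ _; rewrite big_ord0.
apply: small_ext (smallD (IH _) (h n (ltnSn n))) => [|i /ltnW/h //].
by exists 0%N => x _ _; rewrite big_ord_recr.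
Qed.

(** A prime larger than the denominator of [c] does not divide it. *)
Lemma small_cst (c : rat) : small 0 (fun _ : X => c).
Proof.
exists `|denq c|.+1 => x _ lt; right; rewrite /vp.
suff -> : logn (pr x) `|denq c| = 0%N by rewrite subr0.
apply/eqP; rewrite -leqn0 leqNgt logn_gt0 mem_primes; apply/negP => /and3P[_ pos /dvdn_leq].
by move=> /(_ pos); rewrite leqNgt lt.
Qed.

Lemma small_pX n : small n (fun x : X => q x ^+ n).
Proof. by exists 0%N => x _ _; apply: vp_ge_pX. Qed.

Lemma smallX n phi : small 0 phi -> small 0 (fun x => phi x ^+ n).
Proof. by move=> [M HM]; exists M => x dx le; apply: vp_geX; apply: HM. Qed.

Lemma small_span (G : gens X) phi : span G phi -> small 0 phi.
Proof.
elim=> [f f0|c g f h Gg _ IH hE].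
  by apply: small_ext (small0 0); exists 0%N => x _ _.
apply: small_ext (smallD (smallM (small_cst c) (gen_small Gg)) IH).
by exists 0%N => x _ _.
Qed.

End Small.

Section Expand.
Variables (X : pts) (G : gens X).
Implicit Types (phi psi : X -> rat).

Lemma expand_ext phi psi :
  (exists M, forall x, dom x -> (M <= pr x)%N -> psi x = phi x) ->
  expand G phi -> expand G psi.
Proof.
move=> [M HM] [F [GF FE]]; exists F; split=> // N.
by apply: small_ext (FE N); exists M => x dx le; rewrite HM.
Qed.

Lemma expand_eq phi psi : (forall x, psi x = phi x) -> expand G phi -> expand G psi.
Proof. by move=> /funext ->. Qed.

Lemma expand_small phi : expand G phi -> small 0 phi.
Proof.
move=> [F [_ /(_ 0%N)]]; apply: small_ext.
by exists 0%N => x _ _; rewrite big_ord0 subr0.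
Qed.

Lemma expand_span phi : span G phi -> expand G phi.
Proof.
move=> sphi; exists (fun j => if j is 0 then phi else fun=> 0); split.
  by case=> [|j] //=; apply: span_nil.
case=> [|N].
  by apply: small_ext (small_span sphi); exists 0%N => x _ _; rewrite big_ord0 subr0.
apply: small_ext (small0 _ N.+1); exists 0%N => x _ _.
rewrite big_ord_recl big1 ?addr0 => [|i _]; last by rewrite mulr0.
by rewrite expr0 mul1r subrr.
Qed.

Lemma expand_gen phi : G phi -> expand G phi.
Proof. by move=> /span_gen/expand_span. Qed.

Lemma expand0 : expand G (fun=> 0).
Proof. by apply: expand_span; apply: span_nil. Qed.

Lemma expandDZ c phi psi :
  expand G phi -> expand G psi -> expand G (fun x => c * phi x + psi x).
Proof.
move=> [F [GF FE]] [H [GH HE]]; exists (fun j x => c * F j x + H j x); split.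
  by move=> j; apply: spanD => //; apply: spanZ.
move=> N; apply: small_ext (smallD (smallM (small_cst X c) (FE N)) (HE N)).
exists 0%N => x _ _; rewrite mulrBr addrACA -opprD; congr (_ - _).
rewrite mulr_sumr -big_split /=; apply: eq_bigr => j _.
by rewrite mulrDr mulrCA.
Qed.

Lemma expandD phi psi :
  expand G phi -> expand G psi -> expand G (fun x => phi x + psi x).
Proof.
move=> ephi epsi; apply: expand_eq (expandDZ 1 ephi epsi) => x.
by rewrite mul1r.
Qed.

Lemma expandZ c phi : expand G phi -> expand G (fun x => c * phi x).
Proof.
by move=> ephi; apply: expand_eq (expandDZ c ephi expand0) => x; rewrite addr0.
Qed.

Lemma expand_sum n (F : nat -> X -> rat) :
  (forall i, (i < n)%N -> expand G (F i)) -> expand G (fun x => \sum_(i < n) F i x).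
Proof.
elim: n => [|n IH] h; first by apply: expand_eq expand0 => x; rewrite big_ord0.
apply: expand_eq (expandD (IH _) (h n (ltnSn n))) => [x|i /ltnW/h //].
by rewrite big_ord_recr.
Qed.

(** Both sides run over the pairs with [i + j < N], grouped by total degree on the left and by [j]
    on the right. *)
Lemma triangular_sum (t : rat) (F : nat -> nat -> rat) N :
  \sum_(k < N) t ^+ k * (\sum_(i < k.+1) F i (k - i)%N) =
  \sum_(j < N) t ^+ j * (\sum_(i < N - j) t ^+ i * F j i).
Proof.
elim: N => [|N IH]; first by rewrite !big_ord0.
rewrite big_ord_recr /= {}IH [RHS]big_ord_recr /= subSn // subnn big_ord1.
rewrite big_ord_recr /= subnn mulrDr addrA expr0 mul1r; congr (_ + _).
rewrite mulr_sumr -big_split /=; apply: eq_bigr => j _.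
rewrite subSn 1?ltnW // big_ord_recr /= mulrDr; congr (_ + _).
by rewrite mulrA -exprD subnKC // ltnW.
Qed.

(** Cutting the expansion of [F j] at order [N - j] leaves an error divisible by
    [p ^ j * p ^ (N - j)], so the double series can be regrouped by total degree. *)
Lemma expand_series (F : nat -> X -> rat) phi :
  (forall j, expand G (F j)) ->
  (forall N, small N (fun x => phi x - \sum_(j < N) q x ^+ j * F j x)) ->
  expand G phi.
Proof.
move=> /choice[H GH] FE.
exists (fun k x => \sum_(i < k.+1) H i (k - i)%N x); split=> [k|N].
  by apply: span_sum => i; have [] := GH i.
apply: (@small_ext _ _ (fun x => (phi x - \sum_(j < N) q x ^+ j * F j x) +
  \sum_(j < N) q x ^+ j * (F j x - \sum_(i < N - j) q x ^+ i * H j i x))).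
  exists 0%N => x _ _.
  rewrite (triangular_sum (q x) (fun j i => H j i x)) -addrA; congr (_ + _).
  under [X in _ = _ + X]eq_bigr do rewrite mulrBr.
  by rewrite sumrB addKr.
apply: smallD => //; apply: (@small_sum X N N (fun j x => q x ^+ j * (F j x - \sum_(i < N - j) q x ^+ i * H j i x))) => j jN.
rewrite -[N in small N](subnKC (ltnW jN)).
by apply: smallM; [exact: small_pX|have [] := GH j].
Qed.

End Expand.

(** * Bilinear summation of two expansions *)

Section BilinearExpand.
Variables (X Y Z : pts) (GX : gens X) (GY : gens Y) (GZ : gens Z).
Variables (n : Z -> nat) (kappa : Z -> nat -> rat).
Variables (alpha : Z -> nat -> X) (beta : Z -> nat -> Y).

(** The number [n z] of terms may grow with the prime, so the finite sums of [expand_sum] do not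
    cover this operator. It suffices to expand it on pairs of generators, provided the weights
    [kappa] are integral. *)
Let op (phi : X -> rat) (psi : Y -> rat) (z : Z) : rat :=
  \sum_(k < n z) kappa z k * phi (alpha z k) * psi (beta z k).

Hypothesis alphaP : forall z k, dom z -> (k < n z)%N ->
  pr (alpha z k) = pr z /\ dom (alpha z k).
Hypothesis betaP : forall z k, dom z -> (k < n z)%N ->
  pr (beta z k) = pr z /\ dom (beta z k).
Hypothesis kappaP : exists M, forall z k, dom z -> (k < n z)%N ->
  (M <= pr z)%N -> vp_ge (pr z) 0 (kappa z k).
Hypothesis opG : forall g h, GX g -> GY h -> expand GZ (op g h).

Lemma small_bilinear N N' phi psi :
  small N phi -> small N' psi -> small (N + N') (op phi psi).
Proof.
move: kappaP => [A HA] [B HB] [C HC]; exists (maxn A (maxn B C)) => z dz.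
rewrite !geq_max => /and3P[hA hB hC]; apply: vp_ge_sum => k _.
have [ea da] := alphaP dz (ltn_ord k); have [eb db] := betaP dz (ltn_ord k).
have /= := HB _ da; rewrite ea => /(_ hB) h1.
have /= := HC _ db; rewrite eb => /(_ hC) h2.
rewrite PoszD -[Posz N]add0r; apply: vp_geM => //; apply: vp_geM => //.
exact: HA.
Qed.

Lemma op_linear_l c f1 f2 h z :
  op (fun x => c * f1 x + f2 x) h z = c * op f1 h z + op f2 h z.
Proof.
rewrite /op mulr_sumr -big_split; apply: eq_bigr => k _ /=; ring.
Qed.

Lemma op_linear_r c f h1 h2 z :
  op f (fun x => c * h1 x + h2 x) z = c * op f h1 z + op f h2 z.
Proof.
rewrite /op mulr_sumr -big_split; apply: eq_bigr => k _ /=; ring.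
Qed.

Lemma expand_bilinear_span phi psi :
  span GX phi -> span GY psi -> expand GZ (op phi psi).
Proof.
apply: span_bilinear; [exact: expand0| |exact: op_linear_l|exact: op_linear_r|by []].
by move=> c k l; apply: expandDZ.
Qed.

Lemma expand_bilinear phi psi :
  expand GX phi -> expand GY psi -> expand GZ (op phi psi).
Proof.
move=> [F [GF FE]] epsi.
(* The first argument is expanded with [psi] fixed, then [psi] is expanded for each [F j]. *)
apply: (@expand_series _ _ (fun j => op (F j) psi)) => [j|N].
  have [H [GH HE]] := epsi.
  apply: (@expand_series _ _ (fun i => op (F j) (H i))) => [i|N].
    exact: expand_bilinear_span.
  apply: small_ext (small_bilinear (small_span (GF j)) (HE N)).
  exists 0%N => z dz _; rewrite /op.
  under [in RHS]eq_bigr do rewrite mulrBr.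
  rewrite sumrB; congr (_ - _).
  under eq_bigr do rewrite mulr_sumr.
  rewrite exchange_big /=; apply: eq_bigr => k _; rewrite mulr_sumr.
  have [-> _] := betaP dz (ltn_ord k).
  by apply: eq_bigr => i _; ring.
rewrite -[N in small N]addn0.
apply: small_ext (small_bilinear (FE N) (expand_small epsi)).
exists 0%N => z dz _; rewrite /op.
under [in RHS]eq_bigr do rewrite mulrBr mulrBl.
rewrite sumrB; congr (_ - _).
under eq_bigr do rewrite mulr_sumr.
rewrite exchange_big /=; apply: eq_bigr => k _; rewrite mulr_sumr mulr_suml.
have [-> _] := alphaP dz (ltn_ord k).
by apply: eq_bigr => i _; ring.
Qed.

End BilinearExpand.

(** * Nested sums *)

Fixpoint nsum (W : int -> nat -> rat) (s : seq int) (n : nat) : rat :=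
  if s is a :: s' then \sum_(i < n) W a i * nsum W s' i else 1.

(* Index [n] stands for the integer [n.+1], so that [hsum s N] is [S_{N,0}(s)]. *)
Definition wt (a : int) (n : nat) : rat := n.+1%:R ^ (- a).

Local Notation hsum := (nsum wt).

Lemma nsumS W a s n : nsum W (a :: s) n.+1 = nsum W (a :: s) n + W a n * nsum W s n.
Proof. by rewrite /= big_ord_recr. Qed.

Lemma nsum0 W s : nsum W s 0 = (s == [::])%:R.
Proof. by case: s => //= a s; rewrite big_ord0. Qed.

Lemma eq_nsum W W' s n :
  (forall a i, (i < n)%N -> W a i = W' a i) -> nsum W s n = nsum W' s n.
Proof.
elim: s n => //= a s IH n eqW; apply: eq_bigr => i _.
rewrite eqW // (IH i) // => b j ji; apply: eqW; exact: ltn_trans (ltn_ord i).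
Qed.

(** The terms are sorted by the number [k] of indices that are at least [M]; as the indices
    decrease, these are the first [k]. *)
Lemma nsum_cat W s M N : nsum W s (M + N) =
  \sum_(k < (size s).+1) nsum (fun a n => W a (M + n)%N) (take k s) N *
                         nsum W (drop k s) M.
Proof.
elim: s N => [|a s IH] N; first by rewrite big_ord1 /= mulr1.
rewrite [RHS]big_ord_recl mul1r /= big_split_ord /=; congr (_ + _).
transitivity (\sum_(i < N) \sum_(k < (size s).+1) W a (M + i)%N *
   (nsum (fun a n => W a (M + n)%N) (take k s) i * nsum W (drop k s) M)).
  by apply: eq_bigr => i _; rewrite IH mulr_sumr.
rewrite exchange_big /=; apply: eq_bigr => k _; rewrite mulr_suml.
by apply: eq_bigr => i _; rewrite mulrA.
Qed.

Lemma vp_ge_nsum (p : primeT) W s n :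
  (forall a i, (i < n)%N -> vp_ge p 0 (W a i)) -> vp_ge p 0 (nsum W s n).
Proof.
elim: s n => [|a s IH] n hW; first exact: (vp_ge_nat p 1).
apply: vp_ge_sum => i _; rewrite -[0]addr0; apply: vp_geM; first exact: hW.
by apply: IH => b j ji; apply: hW; apply: ltn_trans (ltn_ord i).
Qed.

Lemma vp_ge_unit (p : primeT) (n : nat) (z : int) :
  ~~ (p %| n)%N -> vp_ge p 0 (n%:R ^ z : rat).
Proof.
move=> pn; have hV : vp_ge p 0 (n%:R^-1 : rat).
  have n0 : n%:Z != 0 by apply: contraNneq pn => -[->]; rewrite dvdn0.
  right; rewrite -div1r (@vp_frac p 1 n) // logn1 sub0r /=.
  by rewrite logn_coprime // prime_coprime // primeTP.
case: z => k; first exact: vp_geX (vp_ge_nat p n).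
by rewrite NegzE -invr_expz -exprVn; apply: vp_geX.
Qed.

Lemma vp_ge_wt (p : primeT) a i : (i.+1 < p)%N -> vp_ge p 0 (wt a i).
Proof. by move=> ip; apply: vp_ge_unit; rewrite gtnNdvd. Qed.

Lemma vp_ge_hsum (p : primeT) s n : (n < p)%N -> vp_ge p 0 (hsum s n).
Proof. by move=> np; apply: vp_ge_nsum => a i ni; apply: vp_ge_wt; lia. Qed.

Lemma wtD a b n : wt a n * wt b n = wt (a + b) n.
Proof. by rewrite /wt -expfzDr ?pnatr_eq0 // opprD. Qed.

(** * Products of nested sums and nonpositive exponents *)

Definition hgen (phi : nat -> rat) : Prop :=
  exists2 u, is_composition u & phi = hsum (map Posz u).

Lemma hgen_cons phi a : (0 < a)%N -> span hgen phi ->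
  span hgen (fun N => \sum_(n < N) wt a n * phi n).
Proof.
move=> a0; elim=> [f f0|c g f h [u cu ->] _ IH hE].
  by apply: span_nil => N; rewrite big1 // => n _; rewrite f0 mulr0.
have Gg : hgen (hsum (map Posz (a :: u))) by exists (a :: u); rewrite //= a0.
apply: (span_cons (c := c) Gg IH) => N; rewrite /= mulr_sumr -big_split.
by apply: eq_bigr => n _ /=; rewrite hE; ring.
Qed.

(** The largest index of the first sum is above, below or equal to that of the second. In the first
    two cases one leading entry is split off, and in the third the two leading exponents add up. *)
Lemma quasi_shuffle u v : is_composition u -> is_composition v ->
  span hgen (fun N => hsum (map Posz u) N * hsum (map Posz v) N).
Proof.
have [n] := ubnP (size u + size v); elim: n u v => // n IH [|a u] [|b v] sz cu cv.
- by apply: (span_ext (phi := hsum [::])) => [N|]; [rewrite mulr1|apply: span_gen; exists [::]].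
- apply: (span_ext (phi := hsum (map Posz (b :: v)))) => [N|]; first by rewrite mul1r.
  by apply: span_gen; exists (b :: v).
- apply: (span_ext (phi := hsum (map Posz (a :: u)))) => [N|]; first by rewrite mulr1.
  by apply: span_gen; exists (a :: u).
have /andP[a0 cu'] := cu; have /andP[b0 cv'] := cv; simpl in sz.
have h1 := hgen_cons a0 (IH u (b :: v) ltac:(rewrite /=; lia) cu' cv).
have h2 := hgen_cons b0 (IH (a :: u) v ltac:(rewrite /=; lia) cu cv').
have ab0 : (0 < a + b)%N by lia.
have h3 := hgen_cons ab0 (IH u v ltac:(lia) cu' cv').
apply: span_ext (spanD (spanD h1 h2) h3) => N.
elim: N => [|N IHN]; first by rewrite /= !big_ord0 mul0r !addr0.
move: IHN; rewrite ![map _ (_ :: _)]/= !nsumS !big_ord_recr /= PoszD -wtD => E.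
rewrite mulrDl !mulrDr E; ring.
Qed.

(** The power of [N] accommodates the boundary terms of summation by parts. *)
Definition phgen (phi : nat -> rat) : Prop :=
  exists k u, is_composition u /\ phi = fun N => N%:R ^+ k * hsum (map Posz u) N.

Lemma expr_pred k : exists c : nat -> rat, forall n,
  (n%:R : rat) ^+ k = \sum_(i < k.+1) c i * n.+1%:R ^+ i.
Proof.
exists (fun i => ((-1) ^+ (k - i)) *+ 'C(k, i)) => n.
have -> : n%:R = -1 + n.+1%:R :> rat by rewrite -natr1; ring.
rewrite exprDn.
by apply: eq_bigr => i _; rewrite mulrnAl.
Qed.

(** The two leading terms of the binomial expansion of [(n.+1 - 1) ^ k.+1] are singled out:
    telescoping the first isolates the power [k] in [sum_by_parts]. *)
Lemma expr_predS k : exists c : nat -> rat, forall n,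
  (n%:R : rat) ^+ k.+1 = n.+1%:R ^+ k.+1 - k.+1%:R * n.+1%:R ^+ k +
    \sum_(i < k) c i * n.+1%:R ^+ i.
Proof.
exists (fun i => ((-1) ^+ (k.+1 - i)) *+ 'C(k.+1, i)) => n.
have -> : n%:R = -1 + n.+1%:R :> rat by rewrite -natr1; ring.
rewrite exprDn !big_ord_recr /=.
rewrite subnn subSn // subnn expr0 mul1r expr1 binn mulr1n binSn addrC.
under eq_bigr do rewrite -mulrnAl.
by rewrite mulN1r mulNrn -[_ ^+ k *+ _]mulr_natl; ring.
Qed.

(* Summation by parts lowers the exponent [j >= 0], or else the depth. *)
Lemma sum_by_parts (h : nat -> rat) j : exists c : nat -> rat, forall N,
  \sum_(n < N) n.+1%:R ^+ j * h n = j.+1%:R^-1 *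
    (N%:R ^+ j.+1 * h N + \sum_(i < j) c i * (\sum_(n < N) n.+1%:R ^+ i * h n)
     - \sum_(n < N) n.+1%:R ^+ j.+1 * (h n.+1 - h n)).
Proof.
have [c cE] := expr_predS j; exists c => N.
have j0 : j.+1%:R != 0 :> rat by rewrite pnatr_eq0.
apply: (mulfI j0); rewrite mulrA divff // mul1r.
elim: N => [|N IH].
  rewrite !big_ord0 big1 => [|i _]; last by rewrite big_ord0 mulr0.
  by rewrite mulr0 expr0n mul0r !(addr0, subr0).
rewrite !big_ord_recr /= mulrDr {}IH.
under [X in _ = _ + X - _]eq_bigr do rewrite big_ord_recr mulrDr /=.
rewrite big_split /=; have := cE N; set S := \sum_(i < j) c i * _ => E.
have -> : \sum_(i < j) c i * (N.+1%:R ^+ i * h N) = S * h N.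
  by rewrite mulr_suml; apply: eq_bigr => i _; rewrite mulrA.
rewrite E; ring.
Qed.

(** A negative [z] is a new positive leading entry. For [z = j >= 0], summation by parts leaves
    smaller powers with the same [u], and a term with the increment of the nested sum; that
    increment is [wt b n] times the sum for the tail, of smaller depth with exponent [j + 1 - b]. *)
Lemma phgen_sum u z : is_composition u ->
  span phgen (fun N => \sum_(n < N) n.+1%:R ^ z * hsum (map Posz u) n).
Proof.
elim: u z => [|b u IHu] [j|k] cu.
- elim/ltn_ind: j => j IHj; have [c cE] := sum_by_parts (hsum [::]) j.
  apply: span_ext cE _; apply: spanZ; apply: spanD.
    apply: spanD; first by apply: span_gen; exists j.+1, [::].
    by apply: span_sum => i; apply: spanZ; apply: IHj.
  by apply: span_nil => N; rewrite big1 ?oppr0 // => n _; rewrite subrr mulr0.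
- apply: (span_ext (phi := fun N => N%:R ^+ 0 * hsum (map Posz [:: k.+1]) N)) => [N|].
    by rewrite mul1r; apply: eq_bigr => n _; rewrite NegzE.
  by apply: span_gen; exists 0%N, [:: k.+1].
- elim/ltn_ind: j => j IHj; have [c cE] := sum_by_parts (hsum (map Posz (b :: u))) j.
  apply: span_ext cE _; apply: spanZ; apply: spanD.
    apply: spanD; first by apply: span_gen; exists j.+1, (b :: u).
    by apply: span_sum => i; apply: spanZ; apply: IHj.
  have /andP[_ cu'] := cu.
  apply: span_ext (spanZ (-1) (IHu (j.+1%:Z - b%:Z) cu')) => N.
  rewrite mulN1r; congr (- _); apply: eq_bigr => n _.
  rewrite [map _ _]/= nsumS addrAC subrr add0r mulrA /wt; congr (_ * _).
  by rewrite expfzDr ?pnatr_eq0.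
- apply: (span_ext (phi := fun N => N%:R ^+ 0 * hsum (map Posz [:: k.+1, b & u]) N)) => [N|].
    by rewrite mul1r; apply: eq_bigr => n _; rewrite NegzE.
  by apply: span_gen; exists 0%N, [:: k.+1, b & u].
Qed.

Lemma phgen_hsum s : span phgen (hsum s).
Proof.
elim: s => [|a s IH].
  by apply: (span_ext (phi := fun N => N%:R ^+ 0 * hsum (map Posz [::]) N)) => [N|];
    [rewrite mulr1|apply: span_gen; exists 0%N, [::]].
rewrite /=; elim: IH => [f f0|c g f h [k [u [cu ->]]] _ IH hE].
  by apply: span_nil => N; rewrite big1 // => n _; rewrite f0 mulr0.
have [d dE] := expr_pred k.
pose t i N := c * d i * (\sum_(n < N) n.+1%:R ^ (i%:Z - a) * hsum (map Posz u) n).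
apply: span_ext (spanD (span_sum (index_enum 'I_k.+1) (F := fun i : 'I_k.+1 => t i) _) IH) => [N|i].
  under [X in _ = X + _]eq_bigr do rewrite /t mulr_sumr.
  rewrite exchange_big -big_split /=; apply: eq_bigr => n _.
  rewrite hE mulrDr; congr (_ + _); rewrite dE mulr_suml !mulr_sumr.
  apply: eq_bigr => i _; rewrite /wt expfzDr ?pnatr_eq0 // -exprnP; ring.
exact/spanZ/phgen_sum.
Qed.

(** * The ring spanned by [p ^ k * H_(p-1)(u)] *)

Definition PP : pts := Pts (fun p : primeT => p) (fun=> True).

Definition FHgen (phi : primeT -> rat) : Prop :=
  exists k u, is_composition u /\
    phi = fun p => p%:R ^+ k * hsum (map Posz u) p.-1.

Lemma FHgen_small (phi : PP -> rat) : FHgen phi -> small 0 phi.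
Proof.
move=> [k [u [_ ->]]]; exists 0%N => p _ _; rewrite -[Posz 0]addr0.
apply: vp_geM; first exact/vp_geX/vp_ge_nat.
by apply: vp_ge_hsum; rewrite ltn_predL prime_gt0 // primeTP.
Qed.

Definition FHg : gens PP := @Gens PP FHgen FHgen_small.

Local Notation FH := (span FHgen).

Lemma FH_cst c : FH (fun=> c).
Proof.
apply: (span_ext (phi := fun p : primeT => c * (p%:R ^+ 0 * hsum (map Posz [::]) p.-1))) => [p|].
  by rewrite !mulr1.
by apply: spanZ; apply: span_gen; exists 0%N, [::].
Qed.

Lemma FH_p : FH (fun p => p%:R).
Proof.
apply: (span_ext (phi := fun p : primeT => (p%:R ^+ 1 * hsum (map Posz [::]) p.-1))) => [p|].
  by rewrite mulr1.
by apply: span_gen; exists 1%N, [::].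
Qed.

Lemma FHM phi psi : FH phi -> FH psi -> FH (fun p => phi p * psi p).
Proof.
apply: (span_bilinear (op := fun f g p => f p * g p)).
- exact: span_nil.
- by move=> c k l hk hl; apply: spanD => //; apply: spanZ.
- by move=> c f1 f2 h p; ring.
- by move=> c f h1 h2 p; ring.
move=> _ _ [k [u [cu ->]]] [l [v [cv ->]]].
apply: (span_ext (phi := fun p : primeT => p%:R ^+ (k + l) *
  (hsum (map Posz u) p.-1 * hsum (map Posz v) p.-1))) => [p|].
  by rewrite exprD; ring.
have := quasi_shuffle cu cv; set f := fun N => _ * _.
rewrite -[fun p => _]/(fun p : primeT => p%:R ^+ (k + l) * f p.-1).
elim=> [g g0|c g g' h [w cw ->] _ IH hE]; first by apply: span_nil => p; rewrite g0 mulr0.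
apply: (@span_cons _ _ c (fun p : primeT => p%:R ^+ (k + l) * hsum (map Posz w) p.-1)) IH _.
  by exists (k + l)%N, w.
by move=> p; rewrite hE; ring.
Qed.

Lemma FHX n phi : FH phi -> FH (fun p => phi p ^+ n).
Proof.
move=> hphi; elim: n => [|n IH]; first exact: FH_cst.
by apply: span_ext (FHM hphi IH) => p; rewrite exprS.
Qed.

Lemma FH_pX n : FH (fun p => p%:R ^+ n).
Proof. exact: FHX FH_p. Qed.

Lemma FH_poly (f : {poly rat}) : FH (fun p => f.[p%:R]).
Proof.
elim/poly_ind: f => [|f c IH]; first by apply: span_nil => p; rewrite horner0.
apply: span_ext (spanD (FHM IH FH_p) (FH_cst c)) => p.
by rewrite hornerD hornerMX hornerC.
Qed.

(** The powers of [N] produced by [phgen_hsum] become powers of [p - 1], which are polynomials in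
    [p]. *)
Lemma FH_hsum s : FH (fun p => hsum s p.-1).
Proof.
elim: (phgen_hsum s) => [f f0|c g f h [k [u [cu ->]]] _ IH hE].
  by apply: span_nil => p; rewrite f0.
have hu : FH (fun p => hsum (map Posz u) p.-1).
  by apply: span_gen; exists 0%N, u; split=> //; apply: funext => p; rewrite mul1r.
apply: span_ext (spanD (spanZ c (FHM (FHX k (spanD FH_p (FH_cst (-1)))) hu)) IH) => p.
by rewrite hE -subn1 natrB // prime_gt0 // primeTP.
Qed.

Lemma expand_mul (X : pts) (G1 G2 G3 : gens X) :
  (forall g h, G1 g -> G2 h -> expand G3 (fun x => g x * h x)) ->
  forall phi psi, expand G1 phi -> expand G2 psi ->
  expand G3 (fun x => phi x * psi x).
Proof.
move=> GM phi psi ephi epsi.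
have := @expand_bilinear X X X G1 G2 G3 (fun=> 1%N) (fun _ _ => 1)
  (fun x _ => x) (fun x _ => x).
move=> /(_ _ _ _ _ phi psi ephi epsi) H; apply: expand_eq (H _ _ _ _) => //.
- by move=> x; rewrite big_ord1 mul1r.
- by exists 0%N => z k _ _ _; apply: (vp_ge_nat _ 1).
by move=> g h Gg Gh; apply: expand_eq (GM g h Gg Gh) => x; rewrite big_ord1 mul1r.
Qed.

Lemma expand_scale (X : pts) (G : gens X) :
  (forall C g, FH C -> G g -> G (fun x => C (pr x) * g x)) ->
  forall C phi, expand FHg C -> expand G phi ->
  expand G (fun x => C (pr x) * phi x).
Proof.
move=> GM C phi eC ephi.
have := @expand_bilinear PP X X FHg G G (fun=> 1%N) (fun _ _ => 1)
  (fun x _ => pr x) (fun x _ => x).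
move=> /(_ _ _ _ _ C phi eC ephi) H; apply: expand_eq (H _ _ _ _) => //.
- by move=> x; rewrite big_ord1 mul1r.
- by exists 0%N => z k _ _ _; apply: (vp_ge_nat _ 1).
move=> g h Gg Gh; apply: expand_eq (expand_gen (GM g h (span_gen Gg) Gh)) => x.
by rewrite big_ord1 mul1r.
Qed.

Lemma expand_pullback (X Z : pts) (GX : gens X) (GZ : gens Z) (alpha : Z -> X) :
  (exists M, forall z, dom z -> (M <= pr z)%N -> dom (alpha z)) ->
  (forall z, pr (alpha z) = pr z) ->
  (forall g, GX g -> expand GZ (fun z => g (alpha z))) ->
  forall phi, expand GX phi -> expand GZ (fun z => phi (alpha z)).
Proof.
move=> [M aD] aP aG phi [F [GF FE]].
apply: (@expand_series _ _ (fun j z => F j (alpha z))) => [j|N].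
  elim: (GF j) => [f f0|c g f h Gg _ IH hE].
    by apply: expand_eq (expand0 GZ) => z; rewrite f0.
  by apply: expand_eq (expandDZ c (aG g Gg) IH) => z; rewrite hE.
have [M' HM'] := FE N; exists (maxn M M') => z dz; rewrite geq_max => /andP[h1 h2].
by have := HM' (alpha z) (aD z dz h1); rewrite aP; apply.
Qed.

Lemma geometric_remainder (r x : rat) N : r != 0 -> r + x != 0 ->
  (r + x)^-1 - \sum_(j < N) (- x) ^+ j * r ^- j.+1 = (- x) ^+ N * r ^- N * (r + x)^-1.
Proof.
move=> r0 rx0; elim: N => [|N IH].
  by rewrite big_ord0 subr0 !expr0 invr1 !mul1r.
rewrite big_ord_recr /= opprD addrA {}IH !exprS !invfM.
by field; rewrite r0 rx0 expf_neq0.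
Qed.

(** The geometric series of [1 / (r + p y)] around [r]. Its exact remainder is [p ^ N] times a
    product of integral factors. *)
Lemma expand_inv (X : pts) (G : gens X) (r y : X -> rat) :
  (forall j, span G (fun x => (- y x) ^+ j * r x ^- j.+1)) ->
  small 0 y -> small 0 (fun x => (r x)^-1) ->
  small 0 (fun x => (r x + q x * y x)^-1) ->
  (exists M, forall x, dom x -> (M <= pr x)%N -> r x != 0 /\ r x + q x * y x != 0) ->
  expand G (fun x => (r x + q x * y x)^-1).
Proof.
move=> Gj hy hr hry [M HM]; exists (fun j x => (- y x) ^+ j * r x ^- j.+1).
split=> // N.
have h1 := smallX N (smallM (smallM (small_cst X (-1)) hy) hr).
have := smallM (smallM (small_pX X N) h1) hry; rewrite !addn0.
apply: small_ext; exists M => x dx le; have [r0 ry0] := HM x dx le.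
transitivity ((r x + q x * y x)^-1 -
  \sum_(j < N) (- (q x * y x)) ^+ j * r x ^- j.+1).
  by congr (_ - _); apply: eq_bigr => j _; rewrite -mulrN exprMn mulrA.
rewrite geometric_remainder //.
by rewrite -mulrN mulN1r !exprMn exprVn !mulrA.
Qed.

Lemma expandX (X : pts) (G : gens X) : expand G (fun=> 1) ->
  (forall g h, G g -> G h -> G (fun x => g x * h x)) ->
  forall n phi, expand G phi -> expand G (fun x => phi x ^+ n).
Proof.
move=> G1 GM n phi ephi; elim: n => [//|n IH].
apply: (@expand_eq _ _ (fun x => phi x * phi x ^+ n)) => [x|]; first by rewrite exprS.
by apply: expand_mul ephi IH => g h Gg Gh; apply/expand_gen/GM.
Qed.

(** * Sums over one block of length [p] *)

Definition BP : pts := @Pts (primeT * nat) fst (fun=> True).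

(* A point [(p, i, r)] stands for the number [p * i + r.+1]. *)
Definition KP : pts :=
  @Pts (primeT * nat * nat) (fun x => x.1.1) (fun x => (x.2.+1 < x.1.1)%N).

(** Here the last coordinate is the length of an initial part of the block, so [p - 1] is
    allowed. *)
Definition AP : pts :=
  @Pts (primeT * nat * nat) (fun x => x.1.1) (fun x => (x.2 < x.1.1)%N).

Lemma small_FH (X : pts) C : FH C -> small 0 (fun x : X => C (pr x)).
Proof.
move=> /(@small_span PP FHg)[M HM]; exists M => x _ le.
exact: HM (pr x) I le.
Qed.

Definition Bgen (phi : BP -> rat) : Prop :=
  exists C a, FH C /\ phi = fun x => C x.1 * x.2%:R ^+ a.

Definition Kgen (phi : KP -> rat) : Prop :=
  exists C a e, FH C /\ phi = fun x => C x.1.1 * x.1.2%:R ^+ a * wt e x.2.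

Definition Agen (phi : AP -> rat) : Prop :=
  exists C a u, FH C /\ phi = fun x => C x.1.1 * x.1.2%:R ^+ a * hsum u x.2.

Lemma small_natX (X : pts) (f : X -> nat) a : small 0 (fun x => (f x)%:R ^+ a).
Proof. by apply: smallX; exists 0%N => x _ _; apply: vp_ge_nat. Qed.

Lemma Bgen_small phi : Bgen phi -> small 0 phi.
Proof.
move=> [C [a [hC ->]]]; apply: (@smallM BP 0 0); first exact: (small_FH BP hC).
exact: small_natX.
Qed.
Definition Bg := Gens Bgen_small.

Lemma Kgen_small phi : Kgen phi -> small 0 phi.
Proof.
move=> [C [a [e [hC ->]]]]; apply: (@smallM KP 0 0).
  apply: (@smallM KP 0 0); first exact: (small_FH KP hC).
  exact: small_natX.
by exists 0%N => x dx _; apply: vp_ge_wt.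
Qed.
Definition Kg := Gens Kgen_small.

Lemma Agen_small phi : Agen phi -> small 0 phi.
Proof.
move=> [C [a [e [hC ->]]]]; apply: (@smallM AP 0 0).
  apply: (@smallM AP 0 0); first exact: (small_FH AP hC).
  exact: small_natX.
by exists 0%N => x dx _; apply: vp_ge_hsum.
Qed.
Definition Ag := Gens Agen_small.

Lemma KgenM g h : Kgen g -> Kgen h -> Kgen (fun x => g x * h x).
Proof.
move=> [C [a [e [hC ->]]]] [D [b [f [hD ->]]]].
exists (fun p => C p * D p), (a + b)%N, (e + f); split; first exact: FHM.
by apply: funext => x; rewrite -wtD exprD; ring.
Qed.

Lemma wt0 n : wt 0 n = 1.
Proof. by []. Qed.

(** The number at the point is [r.+1 + p * i], with [r.+1] prime to [p]. A negative exponent [a]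
    gives a polynomial in this number, the others a power of its inverse, expanded as a geometric
    series. *)
Lemma expand_block_wt a : expand Kg (fun x => wt a (x.1.1 * x.1.2 + x.2)).
Proof.
pose lin (x : KP) : rat := x.2.+1%:R + q x * x.1.2%:R.
have linE (x : KP) : lin x = (x.1.1 * x.1.2 + x.2).+1%:R.
  by rewrite /lin -addnS natrD natrM addrC.
have K1 : expand Kg (fun=> 1).
  apply: expand_gen; exists (fun=> 1), 0%N, 0; split; first exact: FH_cst.
  by apply: funext => x; rewrite !mul1r.
case: a => n; last first.
  apply: (@expand_eq _ _ (fun x => lin x ^+ n.+1)) => [x|].
    by rewrite linE /wt NegzE opprK.
  apply: expandX => //; first exact: KgenM.
  apply: expandD; apply: expand_gen.
    exists (fun=> 1), 0%N, (-1); split; first exact: FH_cst.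
    by apply: funext => x; rewrite !mul1r.
  exists (fun p => p%:R), 1%N, 0; split; first exact: FH_p.
  by apply: funext => x; rewrite [wt _ _]wt0 mulr1.
apply: (@expand_eq _ _ (fun x => (lin x)^-1 ^+ n)) => [x|].
  by rewrite linE /wt -invr_expz exprVn.
apply: expandX => //; first exact: KgenM.
apply: expand_inv => [j||||].
- apply: span_gen; exists (fun=> (-1) ^+ j), j, j.+1%:Z; split; first exact: FH_cst.
  by apply: funext => x; rewrite [in LHS]exprNn /wt -invr_expz -exprnP.
- exact: (@small_natX KP _ 1).
- exists 0%N => x dx _; apply: (@vp_ge_unit (pr x) x.2.+1 (-1)).
  by rewrite gtnNdvd.
- exists 0%N => x dx _; rewrite -/(lin x) linE.
  apply: (@vp_ge_unit (pr x) _ (-1)); rewrite -addnS dvdn_addr ?dvdn_mulr //.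
  by rewrite gtnNdvd.
by exists 0%N => x _ _; rewrite -/(lin x) linE !pnatr_eq0.
Qed.

Definition block_sum (u : seq int) (p i n : nat) : rat :=
  nsum (fun a n => wt a (p * i + n)) u n.

(** The outermost index bounds the inner sum, so the induction on depth needs all partial lengths of
    the block. *)
Lemma expand_block_partial u : expand Ag (fun x => block_sum u x.1.1 x.1.2 x.2).
Proof.
elim: u => [|a u IH].
  apply: expand_gen; exists (fun=> 1), 0%N, [::]; split; first exact: FH_cst.
  by apply: funext => x; rewrite !mul1r.
have := @expand_bilinear KP AP AP Kg Ag Ag (fun x => x.2) (fun _ _ => 1)
  (fun x k => (x.1, k)) (fun x k => (x.1, k)).
move=> /(_ _ _ _ _ _ _ (expand_block_wt a) IH) H.
apply: expand_eq (H _ _ _ _) => /=.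
- by move=> x; apply: eq_bigr => k _; rewrite mul1r.
- by move=> [x r] k /= h1 h2; split=> //; apply: leq_ltn_trans h1.
- by move=> [x r] k /= h1 h2; split=> //; apply: ltn_trans h1.
- by exists 0%N => z k _ _ _; apply: (vp_ge_nat _ 1).
move=> _ _ [C [b [e [hC ->]]]] [D [c [v [hD ->]]]].
apply: expand_gen; exists (fun p => C p * D p), (b + c)%N, (e :: v).
split; first exact: FHM.
apply: funext => x; rewrite /= mulr_sumr; apply: eq_bigr => k _.
by rewrite exprD; ring.
Qed.

(** At full length [p - 1] the inner sums become coefficients in the span of [FHgen], and only
    powers of the block number remain. *)
Lemma expand_block u : expand Bg (fun x => block_sum u x.1 x.2 (x.1 : nat).-1).
Proof.
have H := @expand_pullback AP BP Ag Bg (fun x => (x, (x.1 : nat).-1)).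
apply: expand_eq (H _ _ _ _ (expand_block_partial u)) => [//|||].
- by exists 0%N => x _ _ /=; rewrite ltn_predL prime_gt0 // primeTP.
- by [].
move=> _ [C [a [v [hC ->]]]]; apply: expand_gen.
exists (fun p => C p * hsum v p.-1), a; split; first exact: FHM hC (FH_hsum v).
by apply: funext => x; rewrite /= mulrAC.
Qed.

(** * Sums up to a multiple of [p] *)

Definition posn (a : int) : nat := if a is Posz n then n else 0.
Definition pos (s : seq int) : nat := sumn (map posn s).

Lemma pos_cat s t : pos (s ++ t) = (pos s + pos t)%N.
Proof. by rewrite /pos map_cat sumn_cat. Qed.

(** Every positive integer up to [x.2] then has valuation at most [d], so the factor
    [p ^ (d * pos e)] in [Wgen] makes the nested sum integral. *)
Definition MP (d : nat) : pts := @Pts (primeT * nat) fst (fun x => (x.2 < x.1 ^ d.+1)%N).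

Definition Wgen (d : nat) (phi : MP d -> rat) : Prop :=
  exists C e, FH C /\ phi = fun x => C x.1 * x.1%:R ^+ (d * pos e) * hsum e x.2.

Lemma vp_ge_pwt (p : primeT) d e i : (i.+1 < p ^ d.+1)%N ->
  vp_ge p 0 (p%:R ^+ (d * posn e) * wt e i).
Proof.
move=> lt; case: e => n; last first.
  by rewrite muln0 mul1r /wt NegzE opprK; apply: vp_geX (vp_ge_nat _ _).
rewrite /= exprM /wt -invr_expz -exprnP -exprVn -exprMn; apply: vp_geX.
right; rewrite -natrX (@vp_frac p (p ^ d)%N i.+1) //=; last first.
  by rewrite eqz_nat -lt0n expn_gt0 prime_gt0 // primeTP.
rewrite pfactorK ?primeTP // subr_ge0 lez_nat.
have /dvdn_leq := pfactor_dvdnn p i.+1; move=> /(_ isT) h.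
rewrite -ltnS -(ltn_exp2l _ _ (prime_gt1 (primeTP p))).
exact: leq_ltn_trans h lt.
Qed.

Lemma Wgen_small d (phi : MP d -> rat) : Wgen phi -> small 0 phi.
Proof.
move=> [C [e [hC ->]]].
apply: (@small_ext (MP d) 0 (fun x => C x.1 * (x.1%:R ^+ (d * pos e) * hsum e x.2))).
  by exists 0%N => x _ _; rewrite mulrA.
apply: (@smallM (MP d) 0 0); first exact: (small_FH (MP d) hC).
exists 0%N => -[p m] /= lt _.
elim: e m lt => [|a e IH] m lt; first by rewrite muln0 mulr1; apply: (vp_ge_nat _ 1).
rewrite /= mulr_sumr; apply: vp_ge_sum => i _.
have -> : p%:R ^+ (d * pos (a :: e)) * (wt a i * hsum e i) =
   (p%:R ^+ (d * posn a) * wt a i) * (p%:R ^+ (d * pos e) * hsum e i) :> rat.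
  by rewrite /pos /= mulnDr exprD; ring.
have im := ltn_ord i.
rewrite -[Posz 0]addr0; apply: vp_geM; first by apply: vp_ge_pwt; apply: leq_ltn_trans lt.
by apply: IH; apply: ltn_trans lt.
Qed.
Definition Wg d := Gens (@Wgen_small d).

Lemma posnB e (l : nat) : (posn (e - l%:Z) <= posn e)%N.
Proof. by case: e => n; rewrite /posn; case E: (_ - _) => [m|m] //; lia. Qed.

(** A power of [i] coming from the block is rewritten in powers of [i.+1] and absorbed into the
    exponent, which becomes [e - l]. Its positive part does not increase, so the leftover power of
    [p] is nonnegative and joins the coefficient. *)
Lemma expand_block_step d e (phi : BP -> rat) (psi : MP d -> rat) :
  expand Bg phi -> expand (Wg d) psi ->
  expand (Wg d) (fun x => \sum_(i < x.2)
     (x.1%:R ^+ (d * posn e) * wt e i) * phi (x.1, i : nat) * psi (x.1, i : nat)).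
Proof.
move=> ephi epsi.
have := @expand_bilinear BP (MP d) (MP d) Bg (Wg d) (Wg d) (fun x => x.2)
  (fun x i => x.1%:R ^+ (d * posn e) * wt e i)
  (fun x k => (x.1, k)) (fun x k => (x.1, k)).
move=> /(_ _ _ _ _ _ _ ephi epsi); apply => /=.
- by [].
- by move=> [p m] k /= h1 h2; split=> //; apply: ltn_trans h1.
- exists 0%N => -[p m] k /= h1 h2 _; apply: vp_ge_pwt; exact: leq_ltn_trans h1.
move=> _ _ [C [a [hC ->]]] [D [s [hD ->]]].
have [c cE] := expr_pred a.
pose t (l : nat) (x : MP d) : rat := c l * ((C x.1 * D x.1 *
  x.1%:R ^+ (d * (posn e - posn (e - l%:Z)))) * x.1%:R ^+ (d * pos (e - l%:Z :: s)) *
  hsum (e - l%:Z :: s) x.2).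
apply: (@expand_eq _ _ (fun x => \sum_(l < a.+1) t l x)) => [x|].
  rewrite /t; under [in RHS]eq_bigr do rewrite /= !mulr_sumr.
  rewrite [RHS]exchange_big /=; apply: eq_bigr => i _; rewrite cE.
  rewrite !mulr_sumr mulr_suml; apply: eq_bigr => l _.
  have -> : wt (e - l%:Z) i = wt e i * i.+1%:R ^+ l.
    by rewrite -wtD /wt opprK.
  have -> : x.1%:R ^+ (d * posn e) = x.1%:R ^+ (d * (posn e - posn (e - l%:Z))) *
     x.1%:R ^+ (d * posn (e - l%:Z)) :> rat.
    by rewrite -exprD -mulnDr subnK // posnB.
  by rewrite /pos /= mulnDr exprD; ring.
apply: (@expand_sum _ _ _ t) => l _; apply: expandZ; apply: expand_gen.
exists (fun p : primeT => C p * D p * p%:R ^+ (d * (posn e - posn (e - l%:Z)))), (e - l%:Z :: s).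
by split=> //; apply: FHM (FH_pX _); apply: FHM.
Qed.

(* [b = true] selects the sums restricted to indices prime to [p]. *)
Definition wtb (b : bool) (p : nat) (a : int) (n : nat) : rat :=
  if b && (p %| n.+1)%N then 0 else wt a n.

Definition tsum b p := nsum (wtb b p).

(* [p ^ xe b d s] clears the denominators of [tsum b p s n] for [n < p ^ d.+1]. *)
Definition xe (b : bool) (d : nat) (s : seq int) : nat :=
  if b then 0%N else (d * pos s)%N.

Lemma xe_cat b d s t : xe b d (s ++ t) = (xe b d s + xe b d t)%N.
Proof. by rewrite /xe pos_cat; case: b; rewrite // mulnDr. Qed.

Lemma xe_cons b d a s : xe b d (a :: s) = (xe b d [:: a] + xe b d s)%N.
Proof. exact: (xe_cat b d [:: a] s). Qed.

(** Sorted by the block [i] containing the largest index: [k] further indices lie in that block, the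
    others in earlier ones. *)
Lemma nsum_blocks W a s p m : nsum W (a :: s) (p * m) =
  \sum_(i < m) \sum_(k < (size s).+1)
    nsum (fun a n => W a (p * i + n)%N) (a :: take k s) p * nsum W (drop k s) (p * i).
Proof.
elim: m => [|m IH]; first by rewrite muln0 nsum0 big_ord0.
rewrite mulnS addnC nsum_cat [(size (a :: s)).+1]/= big_ord_recl mul1r [drop 0 _]/= IH.
by rewrite [RHS]big_ord_recr.
Qed.

(** The only multiple of [p] in the block is its last number [p * i.+1], so within the block it can
    only be the largest index. *)
Lemma block_split b (p : primeT) a u i :
  nsum (fun a n => wtb b p a (p * i + n)%N) (a :: u) p =
  block_sum (a :: u) p i (p : nat).-1 +
  (if b then 0 else p%:R ^ (- a) * wt a i) * block_sum u p i (p : nat).-1.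
Proof.
have p0 : (0 < p)%N by rewrite prime_gt0 // primeTP.
have E v : nsum (fun a n => wtb b p a (p * i + n)%N) v p.-1 = block_sum v p i p.-1.
  apply: eq_nsum => c n np; rewrite /wtb; case: ifP => // /andP[_].
  by rewrite -addnS dvdn_addr ?dvdn_mulr // gtnNdvd //; lia.
rewrite -[X in nsum _ _ X = _](prednK p0) nsumS !E; congr (_ + _ * _).
rewrite /wtb -addnS prednK // -mulnSr dvdn_mulr // andbT; case: b {E} => //.
by rewrite /wt -addnS prednK // -mulnSr natrM exprzMl // unitfE pnatr_eq0 -?lt0n.
Qed.

Lemma WgenM d (C : primeT -> rat) (g : MP d -> rat) :
  FH C -> Wgen g -> Wgen (fun x => C x.1 * g x).
Proof.
move=> hC [D [e [hD ->]]]; exists (fun p => C p * D p), e.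
by split; [exact: FHM|apply: funext => x; rewrite !mulrA].
Qed.

Lemma expand_scalep d n (phi : MP d -> rat) :
  expand (Wg d) phi -> expand (Wg d) (fun x => x.1%:R ^+ n * phi x).
Proof.
apply: (@expand_scale (MP d) (Wg d) (@WgenM d) (fun p : primeT => p%:R ^+ n)).
exact: (@expand_span PP FHg _ (FH_pX n)).
Qed.

(** Strong induction on depth through [nsum_blocks]. [B] collects the terms whose largest index is
    prime to [p], and [B'] those where it is a multiple of [p]. *)
Lemma expand_tsum b d s : expand (Wg d)
  (fun x => x.1%:R ^+ xe b d.+1 s * tsum b x.1 s (x.1 * x.2)%N).
Proof.
have [n] := ubnP (size s); elim: n s => // n IH [|a s] sz.
  apply: expand_gen; exists (fun=> 1), [::]; split; first exact: FH_cst.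
  by apply: funext => x; rewrite /xe /pos /= !muln0 if_same expr0.
pose B k (x : MP d) : rat := \sum_(i < x.2)
  (* The first factor equals 1; it gives [B] the shape required by [expand_block_step] with exponent
     0. *)
  (x.1%:R ^+ (d * posn 0) * wt 0 i) * block_sum (a :: take k s) x.1 i (x.1 : nat).-1 *
  (x.1%:R ^+ xe b d.+1 (drop k s) * tsum b x.1 (drop k s) (x.1 * i)%N).
pose B' k (x : MP d) : rat := \sum_(i < x.2)
  (x.1%:R ^+ (d * posn a) * wt a i) * block_sum (take k s) x.1 i (x.1 : nat).-1 *
  (x.1%:R ^+ xe b d.+1 (drop k s) * tsum b x.1 (drop k s) (x.1 * i)%N).
have eT k : expand (Wg d) (fun x => x.1%:R ^+ xe b d.+1 (drop k s) *
    tsum b x.1 (drop k s) (x.1 * x.2)%N).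
  by apply: IH; rewrite size_drop; move: sz => /=; lia.
have eB k : expand (Wg d) (B k).
  exact: (expand_block_step 0 (expand_block (a :: take k s)) (eT k)).
have eB' k : expand (Wg d) (B' k).
  exact: (expand_block_step a (expand_block (take k s)) (eT k)).
pose t k (x : MP d) : rat := x.1%:R ^+ xe b d.+1 (a :: take k s) * B k x +
  (if b then 0 else 1) *
    (x.1%:R ^+ (xe b d.+1 (take k s) + posn (- a)) * B' k x).
apply: (@expand_eq _ _ (fun x => \sum_(k < (size s).+1) t k x)) => [x|].
  rewrite /tsum nsum_blocks exchange_big mulr_sumr; apply: eq_bigr => k _.
  rewrite /t /B /B' !mulr_sumr -big_split; apply: eq_bigr => i _.
  rewrite block_split xe_cons -{1}(cat_take_drop k s) xe_cat.
  rewrite muln0 expr0 -[wt 0 i]/(1 : rat) [xe b d.+1 (a :: take k s)]xe_cons !exprD /tsum.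
  case: (b) => /=; first by rewrite /xe /=; ring.
  (* Of the [d.+1] copies of [p ^ posn a], one cancels [p ^ (- a)] when [a] is positive; when [a] is
     negative, [p ^ posn (- a)] is left over. *)
  have E : x.1%:R ^+ xe false d.+1 [:: a] * x.1%:R ^ (- a) =
            x.1%:R ^+ posn (- a) * x.1%:R ^+ (d * posn a) :> rat.
    have p0 : x.1%:R != 0 :> rat by rewrite pnatr_eq0 -lt0n prime_gt0 // primeTP.
    rewrite -exprD !exprnP -expfzDr //; congr (_ ^ _).
    by rewrite /xe /pos /=; case: (a) => [[|m]|m]; rewrite /= ?NegzE ?opprK /=; lia.
  ring: E.
apply: (@expand_sum _ _ _ t) => k _; apply: expandD; first exact: expand_scalep.
by apply: expandZ; apply: expand_scalep.
Qed.

(** * Upper bounds given by polynomials *)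

Lemma expand_FH (phi : PP -> rat) : FH phi -> expand FHg phi.
Proof. by move=> h; apply: expand_span. Qed.

Lemma expand_FHM (phi psi : PP -> rat) : expand FHg phi -> expand FHg psi ->
  expand FHg (fun p => phi p * psi p).
Proof.
by apply: expand_mul => g h Gg Gh; apply/expand_FH/FHM; apply: span_gen.
Qed.

Lemma expand_FHX n (phi : PP -> rat) :
  expand FHg phi -> expand FHg (fun p => phi p ^+ n).
Proof.
move=> ephi; elim: n => [|n IH]; first exact: expand_FH (FH_cst 1).
apply: expand_eq (expand_FHM ephi IH) => p; exact: exprS.
Qed.

Definition ev_nonneg (f : {poly int}) : Prop :=
  almost_all_primes (fun p => 0 <= f.[p%:Z]).

Lemma poly_split (f : {poly int}) : exists (g : {poly int}) (c : int),
  f = g * 'X + c%:P /\ (size g <= (size f).-1)%N.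
Proof.
elim/poly_ind: f => [|g c _]; first by exists 0, 0; rewrite mul0r addr0 size_poly0.
exists g, c; split=> //; rewrite size_MXaddC; case: ifP => // /andP[/eqP-> _].
by rewrite size_poly0.
Qed.

Lemma lead_coef_ev_pos (f : {poly int}) : 0 < lead_coef f ->
  eventually_nat (fun n => 0 < f.[n%:Z]).
Proof.
elim/poly_ind: f => [|f c IH]; first by rewrite lead_coef0.
have [->|f0] := eqVneq f 0.
  by rewrite mul0r add0r lead_coefC => c0; exists 0%N => n _; rewrite hornerC.
have fX : (size c%:P < size (f * 'X)%R)%N.
  rewrite size_mulX //; apply: leq_ltn_trans (size_polyC_leq1 c) _.
  by rewrite ltnS lt0n size_poly_eq0.
rewrite lead_coefDl // lead_coefMX => /IH[N HN].
exists (maxn N `|c|.+1) => n; rewrite geq_max => /andP[/HN h1 h2].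
by rewrite hornerD hornerMX hornerC; nia.
Qed.

Lemma ev_lt_pX (f : {poly int}) d : (size f <= d.+1)%N ->
  eventually_nat (fun n => f.[n%:Z] < (n ^ d.+1)%N%:Z).
Proof.
move=> sf; have : 0 < lead_coef ('X^(d.+1) - f).
  by rewrite lead_coefDl ?lead_coefXn // size_polyN size_polyXn.
move=> /lead_coef_ev_pos[N HN]; exists N => n /HN.
by rewrite hornerD hornerN hornerXn subr_gt0 -[Posz (n ^ _)]natz natrX natz.
Qed.

(** * Inverses of polynomial values *)

Section InversePolynomial.
Variables (g : {poly int}) (N : primeT -> nat).
Hypothesis N_gt0 : forall p, (0 < N p)%N.
Hypothesis NE : almost_all_primes (fun p => (N p)%:Z = g.[p%:Z]).

Lemma expand_polyval : expand FHg (fun p : primeT => (N p)%:R).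
Proof.
apply: (expand_ext _ (expand_FH (FH_poly (map_poly intr g)))).
have [M HM] := NE; exists M => p _ /HM E.
have -> : (nat_of_primeT p)%:R = (Posz (nat_of_primeT p))%:~R :> rat by [].
by rewrite horner_map -E.
Qed.

(** Modulo [p] the value is [g.[0]], and a prime above the absolute value of [g.[0]] divides it only
    if it is 0. *)
Lemma dvd_polyval : almost_all_primes (fun p => (p %| N p)%N = (g.[0] == 0)).
Proof.
have [M HM] := NE; exists (maxn M `|g.[0]|.+1) => p; rewrite geq_max.
move=> /andP[/HM E lt]; have [g1 [c [gE _]]] := poly_split g.
have c0 : g.[0] = c by rewrite gE hornerD hornerMX mulr0 add0r hornerC.
move: E lt; rewrite {}c0 {}gE hornerD hornerMX hornerC => E lt.
have -> : (p %| N p)%N = (p%:Z %| c)%Z.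
  by rewrite -[LHS]/(p%:Z %| (N p)%:Z)%Z E rpredDl // dvdz_mull.
rewrite dvdzE /=; apply/idP/eqP => [|->]; last by rewrite absz0 dvdn0.
by have [//|c0] := eqVneq c 0; rewrite gtnNdvd // absz_gt0.
Qed.

Lemma expand_polyval_inv : g.[0] != 0 -> expand FHg (fun p : primeT => (N p)%:R^-1).
Proof.
move=> g0; have [g1 [c [gE _]]] := poly_split g.
have c0 : g.[0] = c by rewrite gE hornerD hornerMX mulr0 add0r hornerC.
rewrite c0 in g0; have cr : c%:~R != 0 :> rat by rewrite intr_eq0.
pose y (p : PP) : rat := (map_poly intr g1).[q p].
have NyE : almost_all_primes (fun p : PP => (N p)%:R = c%:~R + q p * y p :> rat).
  have [M HM] := NE; exists M => p /HM /(congr1 (fun z : int => z%:~R : rat)).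
  rewrite gE hornerD hornerMX hornerC intrD intrM /y => E.
  have -> : (p : nat)%:R = p%:Z%:~R :> rat by [].
  by rewrite horner_map /= addrC mulrC -E.
have hy : FH y by exact: FH_poly.
apply: (@expand_ext _ _ (fun p => (c%:~R + q p * y p)^-1)).
  by have [M HM] := NyE; exists M => p _ /HM ->.
apply: (@expand_inv PP FHg (fun=> c%:~R)) => [j||||].
- have := FHM (FHX j (spanZ (-1) hy)) (FH_cst ((c%:~R : rat) ^- j.+1)).
  by apply: span_ext => p; rewrite mulN1r.
- exact: (@small_span PP FHg).
- exact: small_cst.
- have [M HM] := almost_all_primesI NyE dvd_polyval.
  exists M => p _ /HM[<- pN]; apply: (@vp_ge_unit p (N p) (-1)).
  by rewrite pN c0.
have [M HM] := NyE; exists M => p _ /HM <-; split=> //.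
by rewrite pnatr_eq0 -lt0n.
Qed.

End InversePolynomial.

(** Each factor ['X] of [g] cancels one power of [p], until the constant term is nonzero and the
    geometric series applies. At [d = 0] a zero constant term would make [g], hence some [N p],
    vanish. *)
Lemma expand_pX_polyval_inv d (g : {poly int}) (N : primeT -> nat) :
  (forall p, (0 < N p)%N) ->
  almost_all_primes (fun p => (N p)%:Z = g.[p%:Z]) -> (size g <= d.+1)%N ->
  expand FHg (fun p : primeT => p%:R ^+ d / (N p)%:R).
Proof.
elim: d g N => [|d IH] g N N0 NE sg; have [g0|g0] := eqVneq g.[0] 0.
- have [M HM] := NE; have [r Mr pr_r] := prime_above M.
  have := HM (exist _ r pr_r) (ltnW Mr).
  have gC : g = (g`_0)%:P by apply: size1_polyC.
  move: g0; rewrite gC !hornerC => -> /eqP; rewrite eqz_nat.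
  by rewrite eqn0Ngt N0.
- apply: expand_eq (expand_polyval_inv N0 NE g0) => p.
  by rewrite expr0 mul1r.
- have [g1 [c [gE sg1]]] := poly_split g.
  have c0 : c = 0 by rewrite -g0 gE hornerD hornerMX mulr0 add0r hornerC.
  have [M HM] := almost_all_primesI NE (dvd_polyval NE).
  (* The value 1 keeps [N1] positive at the finitely many primes where [p] fails to divide [N p]. *)
  pose N1 (p : primeT) := if (p %| N p)%N then (N p %/ p)%N else 1%N.
  have N1_gt0 p : (0 < N1 p)%N.
    rewrite /N1; case: ifP => // dv; rewrite divn_gt0; first exact: dvdn_leq.
    exact: prime_gt0 (primeTP p).
  apply: expand_ext (IH g1 N1 N1_gt0 _ _).
  + exists M => p _ /HM[E]; rewrite g0 eqxx => dv; rewrite /N1 dv.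
    have p0 : (nat_of_primeT p)%:R != 0 :> rat by rewrite pnatr_eq0 -lt0n prime_gt0 // primeTP.
    rewrite -{1}(divnK dv) natrM exprS.
    have d0 : (N p %/ nat_of_primeT p)%:R != 0 :> rat by have := N1_gt0 p; rewrite /N1 dv pnatr_eq0 -lt0n.
    by field; rewrite p0 d0.
  + exists M => p /HM[E]; rewrite g0 eqxx => dv; rewrite /N1 dv.
    have p0 : p%:Z != 0 by rewrite eqz_nat -lt0n prime_gt0 // primeTP.
    apply: (mulIf p0); rewrite -PoszM divnK // E gE c0.
    by rewrite hornerD hornerMX hornerC addr0.
  + by apply: leq_trans sg1 _; move: sg; lia.
- exact: expand_FHM (expand_FH (FH_pX d.+1)) (expand_polyval_inv N0 NE g0).
Qed.

(** Index [h(p)] stands for the integer [h(p) + 1], hence the polynomial [h + 1]. In the restricted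
    case the weight is eventually 0 or a power of a unit, according to the constant term of
    [h + 1]. *)
Lemma expand_end_wt b d a (h : {poly int}) :
  ev_nonneg h -> (size (h + 1)%R <= d.+1)%N ->
  expand FHg (fun p : primeT => p%:R ^+ xe b d [:: a] * wtb b p a (poly_val h p)).
Proof.
move=> [M hM] sg; pose N p := (poly_val h p).+1.
have N0 p : (0 < N p)%N by [].
have NE : almost_all_primes (fun p => (N p)%:Z = (h + 1).[p%:Z]).
  exists M => p /hM h0; rewrite hornerD hornerC /N /poly_val -addn1 PoszD gez0_abs //.
have dvN := dvd_polyval NE.
case: b.
  have [g0|g0] := eqVneq (h + 1).[0] 0.
    apply: expand_ext (expand0 FHg); have [M' HM'] := dvN; exists M' => p _ /HM'.
    by rewrite g0 eqxx /wtb => -> /=; rewrite mulr0.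
  apply: (@expand_ext PP FHg (fun p : primeT => wt a (N p).-1)).
    have [M' HM'] := dvN; exists M' => p _ /HM'.
    by rewrite (negPf g0) /wtb /xe expr0 mul1r => ->.
  case: a => n.
    apply: expand_eq (expand_FHX n (expand_polyval_inv N0 NE g0)) => p.
    by rewrite /wt -invr_expz exprVn.
  apply: expand_eq (expand_FHX n.+1 (expand_polyval NE)) => p.
  by rewrite /wt NegzE opprK.
rewrite /wtb /= /xe /pos /= addn0; case: a => n /=.
  apply: expand_eq (expand_FHX n (expand_pX_polyval_inv N0 NE sg)) => p.
  by rewrite /wt -invr_expz exprMn exprVn exprM.
apply: expand_eq (expand_FHX n.+1 (expand_polyval NE)) => p.
by rewrite muln0 mul1r /wt NegzE opprK.
Qed.

Definition good b d (h : {poly int}) : Prop := forall s,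
  expand FHg (fun p : primeT => p%:R ^+ xe b d s * tsum b p s (poly_val h p)).

Lemma tsum_nilE b d (n : primeT -> nat) :
  expand FHg (fun p : primeT => p%:R ^+ xe b d [::] * tsum b p [::] (n p)).
Proof.
apply: expand_eq (expand_FH (FH_cst 1)) => p.
by rewrite /xe /pos muln0 if_same mulr1.
Qed.

Lemma poly_val_succ h : ev_nonneg h ->
  almost_all_primes (fun p => poly_val (h + 1) p = (poly_val h p).+1).
Proof.
move=> [M hM]; exists M => p /hM h0; rewrite /poly_val hornerD hornerC; lia.
Qed.

(** The two sums differ by the last weight times a sum of smaller depth. Going down, that shorter
    sum is supplied by induction on [s]. *)
Lemma good_succ b d h : ev_nonneg h -> (size (h + 1)%R <= d.+1)%N ->
  good b d h <-> good b d (h + 1).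
Proof.
move=> h0 sg; have [M HM] := poly_val_succ h0; split=> H.
  case=> [|a s]; first exact: tsum_nilE.
  apply: expand_ext (expandD (H (a :: s)) (expand_FHM (expand_end_wt b a h0 sg) (H s))).
  exists M => p _ /HM ->; rewrite /tsum nsumS mulrDr; congr (_ + _).
  by rewrite xe_cons exprD; ring.
elim=> [|a s IH]; first exact: tsum_nilE.
apply: expand_ext (expandDZ (-1) (expand_FHM (expand_end_wt b a h0 sg) IH) (H (a :: s))).
exists M => p _ /HM ->; rewrite /tsum nsumS [xe b d (a :: s)]xe_cons exprD.
by ring.
Qed.

Lemma good_addn b d h n : ev_nonneg h -> (size h <= d.+1)%N ->
  good b d h <-> good b d (h + n%:R%:P).
Proof.
move=> h0 sh; elim: n => [|n IH]; first by rewrite addr0.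
have E : h + n.+1%:R%:P = (h + n%:R%:P) + 1 by rewrite -natr1 polyCD addrA.
rewrite IH E; apply: good_succ.
  by have [M HM] := h0; exists M => p /HM ?; rewrite hornerD hornerC; lia.
rewrite -E; apply: leq_trans (size_polyD _ _) _; rewrite geq_max sh.
exact: leq_trans (size_polyC_leq1 _) _.
Qed.

(** [expand_tsum] is evaluated at [m = Q(p)], which is below [p ^ d.+1] for large [p]. Its
    generators contain unrestricted sums up to [m], so the hypothesis has [false] for either value
    of [b]. *)
Lemma good_block b d Q : ev_nonneg Q -> (size Q <= d.+1)%N ->
  good false d Q -> good b d.+1 (Q * 'X).
Proof.
move=> Q0 sQ gQ s.
have H := @expand_pullback (MP d) PP (Wg d) FHg (fun p : primeT => (p, poly_val Q p)).
apply: expand_eq (H _ _ _ _ (expand_tsum b d s)) => [p|||].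
- by rewrite /poly_val hornerMX abszM mulnC.
- have [M HM] := Q0; have [M' HM'] := ev_lt_pX sQ.
  exists (maxn M M') => p _ /=; rewrite geq_max => /andP[/HM h1 /HM' h2].
  by rewrite -ltz_nat /poly_val gez0_abs.
- by [].
move=> _ [C [e [hC ->]]].
by apply: expand_eq (expand_FHM (expand_FH hC) (gQ e)) => p; rewrite mulrA.
Qed.

Lemma good_of_quotient b d Q c : ev_nonneg (Q * 'X + c%:P) ->
  (size (Q * 'X)%R <= d.+1)%N -> (ev_nonneg Q -> good b d (Q * 'X)) ->
  good b d (Q * 'X + c%:P).
Proof.
move=> h0 sQ gQ; have Q0 : ev_nonneg Q.
  have [M HM] := h0; exists (maxn M `|c|.+1) => p.
  rewrite geq_max => /andP[/HM + lt]; rewrite hornerD hornerMX hornerC => h1.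
  by nia.
have QX0 : ev_nonneg (Q * 'X).
  by have [M HM] := Q0; exists M => p /HM h1; rewrite hornerMX; nia.
have sQc : (size (Q * 'X + c%:P)%R <= d.+1)%N.
  apply: leq_trans (size_polyD _ _) _; rewrite geq_max sQ.
  exact: leq_trans (size_polyC_leq1 _) _.
case: c h0 sQc => n h0 sQc.
  by rewrite -[Posz n]natz; apply/(good_addn b n QX0 sQ)/gQ.
(* For negative [c] the equivalence is used downwards: adding [n.+1] to the polynomial gives back
   [Q * 'X]. *)
apply/(good_addn b n.+1 h0 sQc); rewrite -addrA -polyCD NegzE natz addNr addr0.
exact: gQ.
Qed.

Lemma good_all b d h : ev_nonneg h -> (size h <= d.+1)%N -> good b d h.
Proof.
have good0 b' d' : good b' d' (0 * 'X).
  case=> [|a s]; first exact: tsum_nilE.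
  apply: expand_eq (expand0 FHg) => p.
  by rewrite /poly_val mul0r horner0 /tsum nsum0 mulr0.
elim: d b h => [|d IH] b h h0 sh; have [Q [c [hE sQ]]] := poly_split h.
  have Q0 : Q = 0 by apply/eqP; rewrite -size_poly_leq0 (leq_trans sQ) //; lia.
  rewrite hE Q0; rewrite hE Q0 in h0; apply: good_of_quotient => [//||_].
    by rewrite mul0r size_poly0.
  exact: good0.
have sQd : (size Q <= d.+1)%N by lia.
rewrite hE; rewrite hE in h0; apply: good_of_quotient => //.
  by apply: leq_trans (size_polyMleq _ _) _; rewrite size_polyX; lia.
by move=> Q0; apply: good_block => //; apply: IH.
Qed.

(** For [N <= M] the truncated subtraction gives the empty range. *)
Definition rsum b p s N M := nsum (fun a n => wtb b p a (M + n)) s (N - M)%N.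

(** Splitting the sum up to [f(p)] at [g(p)] gives the wanted sum as the term with all indices in
    the upper part. The other terms involve a shorter upper sum, known by induction, and a sum up to
    [g(p)]. *)
Lemma expand_rsum b d f g :
  ev_nonneg f -> ev_nonneg g -> (size f <= d.+1)%N -> (size g <= d.+1)%N ->
  almost_all_primes (fun p => (poly_val g p <= poly_val f p)%N) ->
  forall s, expand FHg (fun p : primeT =>
    p%:R ^+ xe b d s * rsum b p s (poly_val f p) (poly_val g p)).
Proof.
move=> f0 g0 sf sg [M HM] s.
have [n] := ubnP (size s); elim: n s => // n IH s; rewrite ltnS => sz.
pose t k (p : primeT) : rat :=
  (p%:R ^+ xe b d (take k s) * rsum b p (take k s) (poly_val f p) (poly_val g p)) *
  (p%:R ^+ xe b d (drop k s) * tsum b p (drop k s) (poly_val g p)).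
apply: (@expand_ext PP FHg (fun p : primeT => -1 * (\sum_(k < size s) t k p) +
   p%:R ^+ xe b d s * tsum b p s (poly_val f p))).
  exists M => p _ /HM le; rewrite -[in tsum _ _ _ (poly_val f _)](subnKC le).
  rewrite /tsum nsum_cat big_ord_recr /= take_size drop_size /= mulr1 mulrDr addrA.
  rewrite mulN1r mulr_sumr; set A := \sum_(k < _) _; set B := \sum_(k < _) _.
  suff -> : A = B by rewrite addNr add0r.
  apply: eq_bigr => k _; rewrite /t -[xe b d s](congr1 _ (cat_take_drop k s)) xe_cat exprD.
  by rewrite /rsum /tsum; ring.
apply: expandDZ; last exact: good_all.
apply: (@expand_sum PP FHg _ t) => k ks; apply: expand_FHM; last exact: good_all.
by apply: IH; rewrite size_take ks; lia.
Qed.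

(** * Nested sums as sums over decreasing tuples *)

Lemma sum_tuple_cons (k : nat) (T : finType) (P : pred (k.+1.-tuple T))
    (F : k.+1.-tuple T -> rat) :
  \sum_(t | P t) F t =
  \sum_(x : T) \sum_(t : k.-tuple T | P [tuple of x :: t]) F [tuple of x :: t].
Proof.
rewrite pair_big_dep /=.
rewrite (reindex (fun xt : T * k.-tuple T => [tuple of xt.1 :: xt.2])) //=.
exists (fun t => (thead t, [tuple of behead t])) => [[x t] _|t _] /=.
  by congr (_, _); apply: val_inj.
by rewrite -tuple_eta.
Qed.

(** The bound [L] is kept apart from the index type, so that the induction can replace it by the
    leading entry of the tuple. *)
Lemma sum_decreasing_tuples (V : int -> nat -> rat) s L N : (L <= N.+1)%N ->
  \sum_(t : (size s).-tuple 'I_N.+1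
        | sorted gtn (map val t) && all (fun x : 'I_N.+1 => (x < L)%N) t)
    \prod_(i < size s) V s`_i (tnth t i) = nsum V s L.
Proof.
elim: s L => [|a s IH] L LN.
  rewrite (big_pred1 [tuple]) => [|t]; first by rewrite big_ord0.
  by rewrite tuple0.
rewrite sum_tuple_cons /= (big_ord_widen _ (fun i => V a i * nsum V s i) LN).
rewrite [RHS]big_mkcond /=; apply: eq_bigr => x _.
have C (t : (size s).-tuple 'I_N.+1) :
    path gtn x (map val t) && ((x < L)%N && all (fun x : 'I_N.+1 => (x < L)%N) t) =
    (x < L)%N && (sorted gtn (map val t) && all (fun y : 'I_N.+1 => (y < x)%N) t).
  rewrite path_sortedE; last by move=> y z w h1 h2; apply: ltn_trans h2 h1.
  rewrite all_map; case: (ltnP x L) => xL; rewrite ?andbF //=.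
  rewrite [X in X && _]andbC -andbA; congr (_ && _); apply: andb_idr.
  by apply: sub_all => y /= yx; apply: ltn_trans xL.
under eq_bigl do rewrite C.
case: ifP => xL; last by rewrite big_pred0.
rewrite -(IH x); last exact: ltnW.
rewrite mulr_sumr; apply: eq_bigr => t _; rewrite big_ord_recl; congr (_ * _).
by apply: eq_bigr => i _; rewrite !(tnth_nth ord0).
Qed.

Lemma nsum_shift V s M K : (forall a n, (n < M)%N -> V a n = 0) ->
  nsum V s (M + K) = nsum (fun a n => V a (M + n)%N) s K.
Proof.
move=> V0; elim: s K => //= a s IH K; rewrite big_split_ord /= big1 ?add0r.
  by apply: eq_bigr => i _; rewrite IH.
by move=> i _; rewrite V0 // mul0r.
Qed.

Lemma dvdn_prodP (p k : nat) (F : 'I_k -> nat) : prime p ->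
  ~~ (p %| \prod_(i < k) F i)%N = [forall i, ~~ (p %| F i)%N].
Proof.
move=> pp; elim: k F => [|k IH] F.
  rewrite big_ord0 dvdn1; apply/idP/forallP => [_ []//|_].
  by apply: contraTneq pp => ->.
rewrite big_ord_recl Euclid_dvdM // negb_or IH; apply/andP/forallP.
  by move=> [h0 /forallP h] i; case: (unliftP ord0 i) => [j ->|->].
by move=> h; split=> //; apply/forallP.
Qed.

Lemma mhs_restr_rsum b (p : primeT) N M s :
  mhs_restr (fun m => ~~ (b && (p %| m)%N)) N M s = rsum b p s N M.
Proof.
pose c n := (M < n)%N && ~~ (b && (p %| n)%N).
(* The side conditions are moved into a weight that vanishes where they fail. Unlike [wt], it is
   indexed by the integer itself. *)
pose V a n : rat := if c n then (n%:R ^ a)^-1 else 0.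
transitivity (nsum V s N.+1).
  rewrite -(sum_decreasing_tuples V s (leqnn N.+1)) /mhs_restr.
  transitivity (\sum_(t : (size s).-tuple 'I_N.+1 |
      sorted gtn (map val t) && [forall i, c (tnth t i)])
      \prod_(i < size s) ((tnth t i : nat)%:R ^ s`_i)^-1 : rat).
    apply: eq_bigl => t; congr (_ && _); apply/andP/forallP.
      move=> [/all_tnthP h1 h2] i; rewrite /c h1 /=; case: b h2 c V => //=.
      by rewrite dvdn_prodP ?primeTP // => /forallP.
    move=> h; split; first by apply/all_tnthP => i; have /andP[] := h i.
    have {}h i : ~~ (b && (p %| tnth t i)%N) by have /andP[] := h i.
    case: b h {c V} => //= h; rewrite dvdn_prodP ?primeTP //; exact/forallP.
  rewrite big_mkcondr; apply: eq_big => [t|t _].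
    by rewrite (introT allP) ?andbT // => x _; rewrite ltn_ord.
  case: ifP => [/forallP h|/negbT]; first by apply: eq_bigr => i _; rewrite /V h.
  rewrite negb_forall => /existsP[i /negPf ci]; rewrite (bigD1 i) //= /V ci.
  by rewrite mul0r.
have V0 a n : (n < M.+1)%N -> V a n = 0 by move=> h; rewrite /V /c ltnNge -ltnS h.
rewrite /rsum; have [MN|NM] := leqP M N.
  rewrite -{1}(subnKC MN) -addSn (nsum_shift _ _ V0); apply: eq_nsum => a n _.
  rewrite /V /c /wtb /wt addSn ltnS leq_addr /= invr_expz.
  by case: (b && _).
have -> : (N - M = 0)%N by lia.
rewrite nsum0; case: s => //= a s; rewrite big1 // => i _.
by rewrite V0 ?mul0r // (leq_trans (ltn_ord i)) //; lia.
Qed.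

Lemma S_sumE (p : primeT) N M s : S_sum N M s = rsum false p s N M.
Proof. by rewrite -mhs_restr_rsum. Qed.

Lemma S_sum_pE (p : primeT) N M s : S_sum_p p N M s = rsum true p s N M.
Proof. by rewrite -mhs_restr_rsum. Qed.

Lemma H_sumE (p : primeT) N u : H_sum N u = hsum (map Posz u) N.
Proof. by rewrite /H_sum (S_sumE p) /rsum subn0. Qed.

(** * From expansions to the MHS algebra *)

Lemma is_class_of_ex (a : primeT -> rat) n :
  almost_all_primes (fun p => vp_ge p n (a p)) -> exists x, is_class_of a x.
Proof.
move=> [N HN].
pose u : prodQp := fun p => if (N <= p)%N then Qp_of_rat p (a p) else 0.
have bu : u \in bounded_pred.
  apply/asboolP; exists n => p; rewrite /u; case: ifP => [/HN h|_].
    exact/Qp_vge_rat.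
  exact: Qp_vge0.
exists (\pi_Qpinf (exist (fun u => u \in bounded_pred) u bu : boundedQp)).
by eexists; split; [reflexivity|exists N => p Np /=; rewrite /u Np].
Qed.

Lemma is_class_ofB a a' x x' : is_class_of a x -> is_class_of a' x' ->
  is_class_of (fun p => a p - a' p) (x - x').
Proof.
move=> [u [<- hu]] [v [<- hv]]; exists (u - v); split; first exact: rmorphB.
have [N HN] := almost_all_primesI hu hv; exists N => p /HN[E E'].
apply: etrans (esym (rmorphB (Qp_of_rat p) _ _)).
exact: (congr2 (fun y z => y - z) E E').
Qed.

Lemma is_class_of_sum (a : nat -> primeT -> rat) t m :
  (forall i, is_class_of (a i) (t i)) ->
  is_class_of (fun p => \sum_(i < m) a i p) (\sum_(i < m) t i).
Proof.
move=> h; elim: m => [|m IH].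
  exists 0; split; first by rewrite rmorph0 big_ord0.
  by exists 0%N => p _; rewrite big_ord0 [RHS]rmorph0.
have [u [uE hu]] := IH; have [v [vE hv]] := h m.
exists (u + v); split; first by rewrite big_ord_recr -uE -vE; exact: rmorphD.
have [N HN] := almost_all_primesI hu hv; exists N => p /HN[E E'].
rewrite big_ord_recr; apply: etrans (esym (rmorphD (Qp_of_rat p) _ _)).
exact: (congr2 (fun y z => y + z) E E').
Qed.

Lemma is_class_of_Fil a x n : is_class_of a x ->
  almost_all_primes (fun p => vp_ge p n (a p)) -> Fil n x.
Proof.
move=> [u [<- hu]] ha; exists u; split=> //.
have [N HN] := almost_all_primesI hu ha; exists N => p /HN[-> h].
exact/Qp_vge_rat.
Qed.

(** * Concatenating finite blocks of terms into one sequence *)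

Section Enumeration.
Variables (T : Type) (x0 : T) (k : T -> nat) (L : nat -> seq T).
Hypothesis L_gt0 : forall j, (0 < size (L j))%N.
Hypothesis L_k : forall j, all (fun x => (j <= k x)%N) (L j).

Definition blocks J := flatten (mkseq L J).
(** As no block is empty, [blocks i.+1] has more than [i] entries and the default [x0] is never
    returned. *)
Definition enumeration i := nth x0 (blocks i.+1) i.

Lemma blocksS J : blocks J.+1 = blocks J ++ L J.
Proof. by rewrite /blocks /mkseq -addn1 iotaD map_cat flatten_cat /= cats0. Qed.

Lemma size_blocks J : (J <= size (blocks J))%N.
Proof. by elim: J => // J IH; rewrite blocksS size_cat; have := L_gt0 J; lia. Qed.

Lemma blocks_prefix J J' : (J <= J')%N ->
  exists2 r, blocks J' = blocks J ++ r & all (fun x => (J <= k x)%N) r.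
Proof.
move=> /subnKC <-; elim: (J' - J)%N => [|n [r E hr]].
  by rewrite addn0; exists [::]; rewrite ?cats0.
exists (r ++ L (J + n)); first by rewrite addnS blocksS E catA.
rewrite all_cat hr; apply: sub_all (L_k (J + n)) => x; apply: leq_trans.
exact: leq_addr.
Qed.

Lemma enumerationE J i : (i < size (blocks J))%N -> enumeration i = nth x0 (blocks J) i.
Proof.
move=> iJ; have [/blocks_prefix[r E _]|/ltnW/blocks_prefix[r E _]] := leqP J i.+1.
  by rewrite /enumeration E nth_cat iJ.
by rewrite E nth_cat size_blocks.
Qed.

Lemma enumeration_ge J i : (size (blocks J) <= i)%N -> (J <= k (enumeration i))%N.
Proof.
move=> Ji; have /blocks_prefix[r E hr] : (J <= i.+1)%N.
  by have := size_blocks J; lia.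
have := size_blocks i.+1; rewrite E size_cat => h.
rewrite /enumeration E nth_cat ltnNge Ji /=.
by apply: (all_nthP x0 hr); lia.
Qed.

Lemma sum_enumeration (g : T -> rat) J r :
  \sum_(i < size (blocks J) + r) g (enumeration i) =
  \sum_(j < J) \sum_(x <- L j) g x +
  \sum_(i < r) g (enumeration (size (blocks J) + i)).
Proof.
rewrite big_split_ord /=; congr (_ + _).
transitivity (\sum_(x <- blocks J) g x).
  rewrite (big_nth x0) big_mkord; apply: eq_bigr => i _.
  by rewrite (enumerationE (ltn_ord i)).
by elim: J => [|J IH]; rewrite ?big_nil ?big_ord0 // blocksS big_cat IH big_ord_recr.
Qed.

End Enumeration.

Lemma FH_list (phi : primeT -> rat) : FH phi ->
  exists l : seq (rat * nat * seq nat), all (fun x => is_composition x.2) l /\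
    forall p, phi p =
      \sum_(x <- l) x.1.1 * p%:R ^+ x.1.2 * hsum (map Posz x.2) p.-1.
Proof.
elim=> [f f0|c g f h [n [u [cu ->]]] _ [l [cl lE]] hE].
  by exists [::]; split=> // p; rewrite big_nil f0.
exists ((c, n, u) :: l); split; first by rewrite /= cu.
by move=> p; rewrite big_cons hE lE mulrA.
Qed.

Lemma vp_ge_pz (p : primeT) (n : int) : vp_ge p n (p%:R ^ n : rat).
Proof.
case: n => n; first exact: vp_ge_pX.
rewrite NegzE -invr_expz -exprnP -natrX -div1r; right.
rewrite (@vp_frac p 1 (p ^ n.+1)%N) //=; last first.
  by rewrite eqz_nat -lt0n expn_gt0 prime_gt0 // primeTP.
by rewrite logn1 sub0r pfactorK ?primeTP.
Qed.

(** The double series in [j] and in the generators of [F j] is listed as a single one. A partial sum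
    past block [J] differs from the expansion cut at order [J] by terms divisible by [p ^ J], and
    multiplying by [p ^ n] shifts every order by [n]. *)
Lemma FilMHS_of_expand (n : int) (a : primeT -> rat) :
  expand FHg (fun p : primeT => p%:R ^ (- n) * a p) ->
  exists2 x, is_class_of a x & FilMHS n x.
Proof.
have p0 (p : primeT) : p%:R != 0 :> rat.
  by rewrite pnatr_eq0 -lt0n; exact: prime_gt0 (primeTP p).
move=> ea; have sc m phi : small m (fun p : PP => (nat_of_primeT p)%:R ^ (- n) * phi p) ->
    almost_all_primes (fun p => vp_ge p (n + m%:Z) (phi p)).
  move=> [M HM]; exists M => p /(HM p I) h.
  rewrite -[phi p](mulKf (expfz_neq0 (- n) (p0 p))) invr_expz opprK.
  by apply: vp_geM => //; apply: vp_ge_pz.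
have [x xa] := is_class_of_ex (sc 0%N _ (expand_small ea)); exists x => //.
have [F [FF FE]] := ea.
have /choice[l lP] := fun j => FH_list (FF j).
pose T := (rat * nat * seq nat)%type.
(* The leading term has coefficient 0 and only ensures that the block is nonempty. *)
pose L j : seq T := (0, j, [::]) :: [seq (y.1.1, (j + y.1.2)%N, y.2) | y <- l j].
pose k (y : T) := y.1.2.
pose g (p : primeT) (y : T) : rat := y.1.1 * p%:R ^+ y.1.2 * hsum (map Posz y.2) p.-1.
have gL j p : \sum_(y <- L j) g p y = p%:R ^+ j * F j p.
  rewrite big_cons big_map /g /= !mul0r add0r (lP j).2 mulr_sumr.
  by apply: eq_bigr => y _; rewrite exprD; ring.
have L0 j : (0 < size (L j))%N by [].
have Lk j : all (fun y => (j <= k y)%N) (L j).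
  by rewrite /= leqnn all_map; apply/allP => y _ /=; apply: leq_addr.
pose e := enumeration ((0, 0%N, [::]) : T) L.
have cL i : is_composition (e i).2.
  apply: (all_nthP ((0, 0%N, [::]) : T) (a := fun y : T => is_composition y.2)); last exact: size_blocks.
  elim: i.+1 => // J IH; rewrite blocksS all_cat IH /= all_map.
  exact: (lP J).1.
have gs y : small (k y) (fun p : PP => g p y).
  have := smallM (smallM (small_cst PP y.1.1) (small_pX PP (k y)))
    (small_FH PP (FH_hsum (map Posz y.2))).
  by rewrite addn0.
pose T' i (p : primeT) : rat := (e i).1.1 * p%:R ^ (n + (k (e i))%:Z) * H_sum p.-1 (e i).2.
have T'E i (p : primeT) : p%:R ^ (- n) * T' i p = g p (e i).
  rewrite /T' /g (H_sumE p) expfzDr // -exprnP.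
  have E : p%:R ^ (- n) * p%:R ^ n = 1 :> rat by rewrite -expfzDr // addNr.
  rewrite !mulrA [_ * (e i).1.1]mulrC -!mulrA; congr (_ * _).
  by rewrite !mulrA E mul1r.
have /choice[t tP] i : exists y, is_class_of (T' i) y.
  apply: (@is_class_of_ex _ (n + (k (e i))%:Z)); apply: sc.
  by apply: small_ext (gs (e i)); exists 0%N => p _ _; apply: T'E.
exists (fun i => (e i).1.1), (fun i => n + (k (e i))%:Z), (fun i => (e i).2).
split; last by move=> i; lia.
split=> //.
  move=> B; exists (size (blocks L `|B - n|%N)) => i /(enumeration_ge (0, 0%N, [::]) L0 Lk) h.
  by move: h; rewrite -/e; lia.
exists t => // B; pose J := `|B - n|%N.
exists (size (blocks L J)) => m /subnKC <-; move: (m - _)%N => r.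
apply: (is_class_of_Fil (is_class_ofB xa (is_class_of_sum _ tP))).
have : almost_all_primes (fun p => vp_ge p (n + J%:Z)
   (a p - \sum_(i < size (blocks L J) + r) T' i p)); last first.
  move=> [M HM]; exists M => p /HM; apply: vp_ge_le; rewrite /J; lia.
apply: sc.
pose R (p : PP) : rat := \sum_(i < r) g p (e (size (blocks L J) + i)%N).
have hR : small J R.
  apply: (@small_sum PP J r (fun i p => g p (e (size (blocks L J) + i)%N))) => i _.
  by apply: small_le (gs _); apply: enumeration_ge => //; apply: leq_addr.
apply: small_ext (smallD (FE J) (smallM (small_cst PP (-1)) hR)).
exists 0%N => p _ _; rewrite mulrBr mulN1r -addrA -opprD; congr (_ - _).
rewrite mulr_sumr; under eq_bigr do rewrite T'E.
rewrite (sum_enumeration _ L0 Lk (g p)); congr (_ + _).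
by apply: eq_bigr => j _; rewrite gL.
Qed.

(** * Ranges between two polynomial values *)

Lemma pos_partE s : \sum_(z <- s) pos_part z = (pos s)%:Z.
Proof.
elim: s => [|a s IH]; first by rewrite big_nil.
rewrite big_cons {}IH /pos /= PoszD; congr (_ + _).
by case: a => // -[].
Qed.

Lemma lead_coef_ev_nonneg f : 0 < lead_coef f -> ev_nonneg f.
Proof.
by move=> /lead_coef_ev_pos[N HN]; exists N => p /HN/ltW.
Qed.

(** If [f - g] has positive leading coefficient, then [g] has degree at most that of [f] and
    [expand_rsum] applies with the degree of [f]. Otherwise the range is eventually empty, and the
    sum is 1 or 0 according to whether [s] is empty. *)
Lemma expand_poly_range b (f g : {poly int}) s :
  0 < lead_coef f -> 0 < lead_coef g ->
  expand FHg (fun p : primeT =>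
    p%:R ^+ xe b (size f).-1 s * rsum b p s (poly_val f p) (poly_val g p)).
Proof.
move=> hf hg; have [f0 g0] := (lead_coef_ev_nonneg hf, lead_coef_ev_nonneg hg).
have [fg|fg] := ltP 0 (lead_coef (f - g)).
  have sgf : (size g <= size f)%N.
    rewrite leqNgt; apply/negP => lt; move: fg.
    by rewrite lead_coefDr ?size_polyN // lead_coefN oppr_gt0 ltNge ltW.
  apply: expand_rsum => //; [by rewrite leqSpred|exact: leq_trans (leqSpred _)|].
  have [N HN] := almost_all_primesI f0 g0; have [N' HN'] := lead_coef_ev_pos fg.
  exists (maxn N N') => p; rewrite geq_max => /andP[/HN[h1 h2] /HN'].
  rewrite hornerD hornerN /poly_val; move: h1 h2; move: (f.[_]) (g.[_]) => x y; lia.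
have le : almost_all_primes (fun p => (poly_val f p <= poly_val g p)%N).
  have gf : ev_nonneg (g - f).
    have [/eqP|n0] := eqVneq (lead_coef (g - f)) 0.
      by rewrite lead_coef_eq0 => /eqP->; exists 0%N => p _; rewrite horner0.
    by apply: lead_coef_ev_nonneg; rewrite lt_def n0 -opprB lead_coefN oppr_ge0.
  have [N HN] := almost_all_primesI f0 (almost_all_primesI g0 gf).
  exists N => p /HN[h1 [h2]]; rewrite hornerD hornerN /poly_val.
  by move: h1 h2; move: (f.[_]) (g.[_]) => x y; lia.
have [M HM] := le; case: s => [|a s].
  by apply: expand_ext (tsum_nilE b (size f).-1 (fun=> 0%N)); exists 0%N.
apply: expand_ext (expand0 FHg); exists M => p _ /HM; rewrite -subn_eq0 => /eqP E.
by rewrite /rsum E nsum0 mulr0.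
Qed.

Theorem theorem3 (s : seq int) (f g : {poly int})
    (hf : 0 < lead_coef f) (hg : 0 < lead_coef g) :
  (exists2 x : Qpinf,
      is_class_of (fun p : primeT => S_sum (poly_val f p) (poly_val g p) s) x
    & FilMHS (- ((size f).-1%:Z * \sum_(z <- s) pos_part z)) x) /\
  (exists2 x : Qpinf,
      is_class_of (fun p : primeT => S_sum_p p (poly_val f p) (poly_val g p) s) x
    & FilMHS 0 x).
Proof.
split; apply: FilMHS_of_expand.
  apply: expand_eq (expand_poly_range false s hf hg) => p.
  by rewrite opprK pos_partE -PoszM -exprnP (S_sumE p).
apply: expand_eq (expand_poly_range true s hf hg) => p.
by rewrite oppr0 expr0z S_sum_pE.
Qed.
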